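(* Let $I$ be a smooth function on an open interval, and let $g\in c_I$ be a Ricci-flat representative of the conformal structure $c_I$ on $M_I$. Then $g$ admits a parallel null vector field and $\mathrm{Hol}(g)\cong\mathbb{R}^3$.
   Context: $M_I=\{(x,y,p,q,z)\in\mathbb{R}^5:x\in\mathrm{dom}\,I\}$, and $I$ is identified with its pullback $I(x)$. With $F_I=-\tfrac12[q^2+\tfrac{10}{3}Ip^2+(1+I^2-I'')y^2]$, $$\omega^1=dy-p\,dx,\quad\omega^2=dz-F_I\,dx-(\partial_qF_I)(dp-q\,dx),\quad\omega^3=dp-q\,dx,\quad\omega^4=dq,\quad\omega^5=dx.$$ The generic $2$-plane field $D_I=\ker\{\omega^1,\omega^2,\omega^3\}$ induces the (Nurowski) conformal structure $c_I=[g_I]$ with $$g_I=-3I(\omega^1)^2+3\,\omega^1\omega^4-10Ip\,\omega^1\omega^5-3\,\omega^2\omega^5-2(\omega^3)^2,\qquad\omega^i\omega^j=\tfrac12(\omega^i\otimes\omega^j+\omega^j\otimes\omega^i).$$ A representative of $c_I$ is a metric $\Omega^2g_I$ with $\Omega$ a positive smooth function on $M_I$. ''Parallel'' is with respect to the Levi-Civita connection of $g$, the parallel null vector field is understood to be nonzero, and $\mathrm{Hol}(g)$ is the holonomy group of that connection. $\mathbb{R}^3$ denotes the additive abelian group. *)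

(* Defs.v *)
From HB Require Import structures.
From mathcomp Require Import all_boot all_order all_algebra.
From mathcomp Require Import all_classical all_reals all_analysis.

Set Implicit Arguments.
Unset Strict Implicit.
Unset Printing Implicit Defensive.

Import Order.TTheory GRing.Theory Num.Theory.
Import numFieldNormedType.Exports.

Local Open Scope classical_set_scope.
Local Open Scope ring_scope.

(* Everything is expressed in the global coordinates of R^n (n >= 1): points,
   tangent vectors and covectors are row vectors of components.  A function that
   matters only on an open set U is a total function whose values outside U are
   irrelevant, because U is open and only derivatives at points of U are used. *)
Section Smoothness.
Variables (R : realType) (n : nat).
Local Notation point := 'rV[R]_n.+1.

Definition smooth1_on (V : normedModType R) (J : set R) (f : R -> V) : Prop :=
  forall (k : nat) (t : R), J t -> derivable (derive1n k f) t 1.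

Definition partial (W : normedModType R) (i : 'I_n.+1) (f : point -> W)
    : point -> W :=
  fun m => 'D_(delta_mx 0 i) f m.

(* C^oo: every iterated partial derivative exists and is Frechet differentiable
   (hence continuous) on U. *)
Definition smooth_on (W : normedModType R) (U : set point) (f : point -> W)
    : Prop :=
  forall (s : seq 'I_n.+1) (m : point), U m ->
    differentiable (foldr (@partial W) f s) m.

End Smoothness.

Section PseudoRiemannian.
Variables (R : realType) (n : nat).
Local Notation point := 'rV[R]_n.+1.
Local Notation vect := 'rV[R]_n.+1.
Local Notation metric := (point -> 'M[R]_n.+1).
Implicit Types (U : set point) (g : metric) (m : point).

(* Gamma^k_{ij} of the Levi-Civita connection. *)
Definition christoffel g (k i j : 'I_n.+1) : point -> R := fun m =>
  2^-1 * \sum_l invmx (g m) k l *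
    (partial i (fun m' => g m' j l) m + partial j (fun m' => g m' i l) m
     - partial l (fun m' => g m' i j) m).

(* R^l_{kij}, the components of
   R(d_i, d_j) d_k = nabla_i nabla_j d_k - nabla_j nabla_i d_k. *)
Definition riemann g (l k i j : 'I_n.+1) : point -> R := fun m =>
  partial i (christoffel g l j k) m - partial j (christoffel g l i k) m
  + \sum_a (christoffel g l i a m * christoffel g a j k m
            - christoffel g l j a m * christoffel g a i k m).

Definition ricci g (k j : 'I_n.+1) : point -> R := fun m =>
  \sum_i riemann g i k i j m.

Definition ricci_flat_on U g : Prop :=
  forall m, U m -> forall k j, ricci g k j m = 0.

Definition conformal_class U (g0 : metric) : set metric :=
  [set g | exists Omega : point -> R,
    [/\ smooth_on U Omega,
        forall m, U m -> 0 < Omega m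
      & forall m, U m -> g m = (Omega m) ^+ 2 *: g0 m]].

Definition parallel_on U g (X : point -> vect) : Prop :=
  smooth_on U X /\
  forall m, U m -> forall i k,
    partial i (fun m' => X m' 0 k) m
    + \sum_j christoffel g k i j m * X m 0 j = 0.

Definition null_on U g (X : point -> vect) : Prop :=
  forall m, U m -> X m *m g m *m (X m)^T = 0.

(* A piecewise smooth curve [0, 1] -> U with break points among
   0 = s_0 < s_1 < ... < s_N = 1, where s = [:: s_1; ...; s_N]. *)
Definition piecewise_smooth U (s : seq R) (c : R -> point) : Prop :=
  [/\ path <%R 0 s, last 0 s = 1,
      forall t, 0 <= t <= 1 -> U (c t)
    & forall k, (k < size s)%N ->
        exists2 d : R -> point, smooth1_on setT d &
          forall t, nth 0 (0 :: s) k <= t <= nth 0 (0 :: s) k.+1 -> c t = d t].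

Definition parallel_along g (s : seq R) (c : R -> point) (V : R -> vect)
    : Prop :=
  {within `[0, 1], continuous V} /\
  forall k, (k < size s)%N ->
    forall t, nth 0 (0 :: s) k < t < nth 0 (0 :: s) k.+1 ->
      is_derive t 1 V
        (- \row_a \sum_i \sum_j
             christoffel g a i j (c t) * (derive1 c t) 0 i * (V t) 0 j).

(* Hol_m(g), as a set of matrices acting on column vectors of components of
   T_m U: the parallel transports along the piecewise smooth loops in U based
   at m. *)
Definition holonomy U g m : set 'M[R]_n.+1 :=
  [set P | exists (s : seq R) (c : R -> point),
    [/\ piecewise_smooth U s c, c 0 = m, c 1 = m
      & forall v : vect, exists V : R -> vect,
          [/\ parallel_along g s c V, V 0 = v & (V 1)^T = P *m v^T]]].

(* The matrix group H is isomorphic to the additive group R^k, as a topological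
   group (H having the subspace topology).  A bare isomorphism of abstract
   groups would not see k, since R and R^k are isomorphic over Q; and a
   continuous morphism between Lie groups is automatically smooth. *)
Definition isomorphic_to_Rn (k : nat) (H : set 'M[R]_n.+1) : Prop :=
  exists (phi : 'rV[R]_k -> 'M[R]_n.+1) (psi : 'M[R]_n.+1 -> 'rV[R]_k),
    [/\ forall u v, phi (u + v) = phi u *m phi v,
        range phi = H,
        cancel phi psi,
        continuous phi
      & {within H, continuous psi}].

End PseudoRiemannian.

Section MI.
Variables (R : realType).
Local Notation point := 'rV[R]_5.

Definition ix : 'I_5 := @Ordinal 5 0 isT.
Definition iy : 'I_5 := @Ordinal 5 1 isT.
Definition ip : 'I_5 := @Ordinal 5 2 isT.
Definition iq : 'I_5 := @Ordinal 5 3 isT.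
Definition iz : 'I_5 := @Ordinal 5 4 isT.

Definition MI (J : set R) : set point := [set m | J (m 0 ix)].

Variable I : R -> R.

Definition FI : point -> R := fun m =>
  let x := m 0 ix in let y := m 0 iy in let p := m 0 ip in let q := m 0 iq in
  - 2^-1 * (q ^+ 2 + 10 / 3 * I x * p ^+ 2
            + (1 + I x ^+ 2 - derive1n 2 I x) * y ^+ 2).

Definition dcoord (i : 'I_5) : 'rV[R]_5 := delta_mx 0 i.

Definition omega1 (m : point) : 'rV[R]_5 := dcoord iy - m 0 ip *: dcoord ix.
Definition omega2 (m : point) : 'rV[R]_5 :=
  dcoord iz - FI m *: dcoord ix
  - partial iq FI m *: (dcoord ip - m 0 iq *: dcoord ix).
Definition omega3 (m : point) : 'rV[R]_5 := dcoord ip - m 0 iq *: dcoord ix.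
Definition omega4 (m : point) : 'rV[R]_5 := dcoord iq.
Definition omega5 (m : point) : 'rV[R]_5 := dcoord ix.

Definition sym_prod (a b : 'rV[R]_5) : 'M[R]_5 :=
  2^-1 *: (a^T *m b + b^T *m a).

Definition gI (m : point) : 'M[R]_5 :=
  (- 3 * I (m 0 ix)) *: sym_prod (omega1 m) (omega1 m)
  + 3 *: sym_prod (omega1 m) (omega4 m)
  - (10 * I (m 0 ix) * m 0 ip) *: sym_prod (omega1 m) (omega5 m)
  - 3 *: sym_prod (omega2 m) (omega5 m)
  - 2 *: sym_prod (omega3 m) (omega3 m).

End MI.

(* Main.v *)
Require Import Defs.
From mathcomp Require Import all_boot all_order all_algebra.
From mathcomp Require Import all_classical all_reals all_analysis.
From mathcomp Require Import ring lra.

(** Write g = Omega^2 g_I and sigma = 1/Omega.  The Ricci tensor of g_I is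
    - I dx^2, and the conformal transformation law turns Ric(g) = 0 into
    sigma Ric(g_I) + 3 Hess(sigma) + mu g_I = 0, where mu is fixed by the
    (x, z) component.  This system is linear and overdetermined in sigma: it
    expresses the second derivatives of sigma by sigma_xz, which takes the place
    of mu, and by lower derivatives.  The equality of mixed third derivatives then
    forces sigma_z = 0 and sigma_q = 0 ([sigma_z0], [sigma_q0]), whereupon the
    equations themselves contain sigma_p = 0 and sigma_y = 0 ([sigma_p0],
    [sigma_y0]).  What is left is sigma = rho(x) with 3 rho'' = I rho
    ([sigma_ode]).

    Since g does not depend on z and g(d_z, _) is a multiple of rho^-2 dx, which
    is closed, d_z is parallel; it is visibly null ([dz_parallel], [dz_null]).

    For the holonomy, let theta' = rho^-2, so that rho and rho theta form a
    basis of the solutions of u'' = I u / 3.  Every product f of two such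
    solutions yields the function
    phi = ((3 f'' - 3 I f) y - 2 f' p + f q) / rho, whose Hessian with respect
    to g is a multiple of dx^2; for f = rho^2 theta^n it is
    - y rho theta^n dx^2.  Completed by the parallel form rho^-2 dx and by one
    more form zeta, the three differentials d phi_n make up a coframe B in which
    g has constant coefficients ([coframe_metric]) and which satisfies
    nabla B = N(r) B dx, where r_n = - y rho^3 theta^n and N is linear with
    values in a commutative algebra of nilpotent matrices ([coframe_eq]).
    Therefore the parallel transport around a loop is B^-1 exp(N(w)) B, where w
    has the components w_n = - \oint y rho^3 theta^n dx, and the holonomy group
    is contained in a copy of R^3 ([holonomy_sub]).

    All of R^3 is reached ([loops], [holonomy_sup]): when x runs back and forth
    along a short segment as x0 + eps (cos(2 pi t) - 1) and
    y = y0 + \sum_b beta_b sin(2 pi t) rho^3 theta^b, the vector w is, up to a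
    nonzero factor, the image of beta under the Gram matrix of the functions
    sin(2 pi t) rho^3 theta^b.  These are linearly independent because theta is
    not constant, so their Gram matrix is invertible.

    The tensor identities are polynomial identities between the coordinates and
    the derivatives of I and sigma.  They are computed on formal differential
    polynomials and then transported to the actual functions. *)

Set Implicit Arguments.
Unset Strict Implicit.
Unset Printing Implicit Defensive.

Import Order.TTheory GRing.Theory Num.Theory.
Import numFieldNormedType.Exports.

Local Open Scope classical_set_scope.
Local Open Scope ring_scope.

(** * Differentiation along curves *)

Lemma differentiable_approx (R : realType) (V W : normedModType R)
    (g : V -> W) (m : V) (e : R) :
  differentiable g m -> 0 < e ->
  \forall v \near (0 : V), `|g (v + m) - g m - 'd g m v| <= e * `|v|.
Proof.
move=> /diff_locally gE e0.
have := (eqaddoP _ _ _ _).1 gE e e0.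
apply: filterS => v /=.
by rewrite !fctE /= opprD addrA.
Qed.

Section Calculus.
Variables (R : realType) (n : nat).
Local Notation point := 'rV[R]_n.+1.
Implicit Types (U : set point) (f g : point -> R) (m : point).
Local Notation e_ i := (delta_mx 0 i : point).

Lemma diff_partial f m v :
  differentiable f m -> 'd f m v = \sum_i v 0 i * partial i f m.
Proof.
move=> df; rewrite [v in LHS]row_sum_delta linear_sum; apply: eq_bigr => i _.
by rewrite linearZ /= /partial deriveE.
Qed.

Lemma is_derive_curve f (c : R -> point) (t : R) dc :
  is_derive t 1 c dc -> differentiable f (c t) ->
  is_derive t 1 (fun s => f (c s)) (\sum_i dc 0 i * partial i f (c t)).
Proof.
move=> [c1 <-] df; rewrite -diff_partial //.
have dc1 : differentiable c t by apply/derivable1_diffP.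
apply: DeriveDef; first by apply: diff_derivable; exact: differentiable_comp.
rewrite !deriveE //; last exact: differentiable_comp.
by rewrite (diff_comp dc1 df).
Qed.

Lemma is_derive_line f m i (t : R) :
  differentiable f (m + t *: e_ i) ->
  is_derive t 1 (fun s : R => f (m + s *: e_ i)) (partial i f (m + t *: e_ i)).
Proof.
move=> df.
have dc : is_derive t 1 (fun s : R => m + s *: e_ i) (e_ i).
  have dm : differentiable (fun s : R => m + s *: e_ i) t by [].
  apply: DeriveDef; first exact: diff_derivable.
  by rewrite deriveE // diff_val /= fctE /= scale1r add0r.
have := is_derive_curve dc df.
rewrite (bigD1 i) //= mxE !eqxx mul1r big1 ?addr0 // => j ji.
by rewrite mxE (negPf ji) andbF mul0r.
Qed.

End Calculus.

(** * Symmetry of second derivatives *)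

Section Schwarz.
Variables (R : realType) (n : nat).
Local Notation point := 'rV[R]_n.+1.
Implicit Types (U : set point) (f g : point -> R) (m : point).
Local Notation e_ i := (delta_mx 0 i : point).

Lemma norm_delta_le1 i : `|e_ i| <= 1.
Proof.
rewrite [leLHS]/Num.Def.normr /= mx_normrE bigmax_le // => -[a b] _ /=.
by rewrite !mxE; case: (_ && _); rewrite ?normr1 ?normr0.
Qed.

Definition second_difference i j f m (h : R) : R :=
  f (m + h *: e_ j + h *: e_ i) - f (m + h *: e_ i)
  - (f (m + h *: e_ j) - f m).

Lemma second_difference_sym i j f m h :
  second_difference i j f m h = second_difference j i f m h.
Proof. by rewrite /second_difference -!addrA [_ *: e_ j + _]addrC; ring. Qed.

(** Applying the mean value theorem in the direction i, and then the
    differentiability of [partial i f] at m, only asks for a second derivative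
    at the single point m. *)
Lemma second_difference_approx U f m i j (e : R) : open U -> U m ->
  (forall m', U m' -> differentiable f m') ->
  differentiable (partial i f) m -> 0 < e ->
  \forall h \near 0^'+,
    `|second_difference i j f m h - h ^+ 2 * partial j (partial i f) m|
      <= 3 * e * h ^+ 2.
Proof.
move=> oU Um df dg e0.
have /nbhs_normP[d1 /= d10 H1] := differentiable_approx dg e0.
have /nbhs_normP[d2 /= d20 H2] : nbhs m U by apply: open_nbhs_nbhs.
near=> h.
have h0 : 0 < h by [].
have small a b : 0 <= a <= h -> 0 <= b <= h ->
    [/\ `|a *: e_ i + b *: e_ j| <= a + b,
        `|a *: e_ i + b *: e_ j| < d1
      & U (m + b *: e_ j + a *: e_ i)].
  move=> /andP[a0 ah] /andP[b0 bh].
  have N : `|a *: e_ i + b *: e_ j| <= a + b.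
    by apply: (le_trans (ler_normD _ _)); apply: lerD;
      rewrite normrZ ger0_norm // ler_piMr // norm_delta_le1.
  have N2 : a + b <= 2 * h by lra.
  have hd1 : 2 * h < d1.
    have : h < d1 / 2 by near: h; apply: nbhs_right_lt; rewrite divr_gt0.
    lra.
  have hd2 : 2 * h < d2.
    have : h < d2 / 2 by near: h; apply: nbhs_right_lt; rewrite divr_gt0.
    lra.
  split => //.
    lra.
  apply: H2.
  rewrite /ball_ /= -addrA opprD addrA subrr sub0r normrN addrC; lra.
pose phi (t : R) : R := f (m + h *: e_ j + t *: e_ i) - f (m + t *: e_ i).
pose dphi (t : R) : R := partial i f (m + h *: e_ j + t *: e_ i)
               - partial i f (m + t *: e_ i).
have phi1 (t : R) : t \in `[0, h] -> is_derive t 1 phi (dphi t).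
  rewrite in_itv /= => th.
  have [_ _ U1] := small t h th (introT andP (conj (ltW h0) (lexx h))).
  have [_ _ U2] := small t 0 th (introT andP (conj (lexx 0) (ltW h0))).
  rewrite scale0r addr0 in U2.
  by apply: is_deriveB; apply: is_derive_line; exact: df.
have phi0 (t : R) : t \in `]0, h[ -> is_derive t 1 phi (dphi t).
  by move=> th; apply: phi1; exact: (subset_itv_oo_cc th).
have phic : {within `[0, h], continuous phi}.
  by apply: derivable_within_continuous => x xh; have [] := phi1 x xh.
have [t th phiE] := MVT_segment (ltW h0) phi0 phic.
rewrite subr0 in phiE.
have -> : second_difference i j f m h = phi h - phi 0.
  by rewrite /phi !scale0r !addr0 /second_difference; ring.
rewrite phiE.
rewrite in_itv /= in th.
have [N1 B1 _] := small t h th (introT andP (conj (ltW h0) (lexx h))).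
have [N2 B2 _] := small t 0 th (introT andP (conj (lexx 0) (ltW h0))).
have H1' v : `|v| < d1 ->
    `|partial i f (v + m) - partial i f m - 'd (partial i f) m v| <= e * `|v|.
  by move=> vd; apply: (H1 v); rewrite /ball_ /= sub0r normrN.
have := H1' _ B1; have := H1' _ B2; rewrite /=.
move: N2; rewrite scale0r !addr0 => N2.
set v1 := t *: e_ i + h *: e_ j; set v2 := t *: e_ i.
move=> A2 A1.
have E12 : 'd (partial i f) m v1 - 'd (partial i f) m v2
    = h * partial j (partial i f) m.
  by rewrite -linearB /v1 /v2 addrAC subrr add0r linearZ /= {2}/partial deriveE.
have -> : dphi t * h - h ^+ 2 * partial j (partial i f) m =
  h * ((partial i f (v1 + m) - partial i f m - 'd (partial i f) m v1)
     - (partial i f (v2 + m) - partial i f m - 'd (partial i f) m v2)).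
  have -> : dphi t = partial i f (v1 + m) - partial i f (v2 + m).
    by rewrite /dphi /v1 /v2 [_ + m]addrC [t *: _ + h *: _]addrC addrA [_ + m]addrC.
  rewrite expr2 -[h * h * partial j _ _]mulrA -E12 [_ - _ - _]addrAC.
  ring.
rewrite normrM gtr0_norm // (_ : 3 * e * h ^+ 2 = h * (e * (h + h) + e * h)); last by ring.
rewrite ler_pM2l // (le_trans (ler_normB _ _)) // lerD //.
  apply: (le_trans A1); rewrite ler_pM2l //; case/andP: th => *; lra.
apply: (le_trans A2); rewrite ler_pM2l //; case/andP: th => *; lra.
Unshelve. all: by end_near. Qed.

(** Young's form of the symmetry theorem: the second difference is symmetric in
    i and j and approximates h^2 times either mixed derivative. *)
Lemma partialC U f m i j : open U -> U m ->
  (forall m', U m' -> differentiable f m') ->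
  differentiable (partial i f) m -> differentiable (partial j f) m ->
  partial i (partial j f) m = partial j (partial i f) m.
Proof.
have absurd_bound (a : R) : 0 < a -> a <= 6 * (a / 12) -> False.
  by move=> a0 a6; lra.
move=> oU Um df di dj; apply/eqP; rewrite -subr_eq0; apply/negP => /negP AB.
set A := _ - _ in AB; have A0 : 0 < `|A| by rewrite normr_gt0.
have e0 : 0 < `|A| / 12 by rewrite divr_gt0.
have H1 := second_difference_approx j oU Um df di e0.
have H2 := second_difference_approx i oU Um df dj e0.
near (0 : R)^'+ => h.
have h0 : 0 < h by [].
have := near H1 h; have := near H2 h.
rewrite [second_difference j i _ _ _]second_difference_sym.
move=> /(_ ltac:(by [])) B2 /(_ ltac:(by [])) B1.
have : `|h ^+ 2 * A| <= 6 * (`|A| / 12) * h ^+ 2.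
  move: B1 B2; rewrite {3}/A; move: (second_difference _ _ _ _ _) `|A| => D a.
  move: (partial i _ m) (partial j _ m) => X Y B1 B2.
  rewrite (_ : h ^+ 2 * (X - Y) = (D - h ^+ 2 * Y) - (D - h ^+ 2 * X)); last by ring.
  rewrite (le_trans (ler_normB _ _)) //; lra.
have h2 : 0 < h ^+ 2 by rewrite exprn_gt0.
rewrite normrM (gtr0_norm h2) [leLHS]mulrC (ler_pM2r h2).
exact: (absurd_bound _ A0).
Unshelve. all: by end_near. Qed.

End Schwarz.

(** * Smooth functions on an open set *)

Section OnOpen.
Variables (R : realType) (n : nat) (U : set 'rV[R]_n.+1).
Hypothesis oU : open U.
Local Notation point := 'rV[R]_n.+1.

Lemma eq_on_near (W : Type) (f g : point -> W) m :
  U m -> (forall m', U m' -> f m' = g m') -> \near m, f m = g m.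
Proof.
by move=> Um fg; near=> m'; apply: fg; near: m'; exact: open_nbhs_nbhs.
Unshelve. all: by end_near. Qed.

Lemma eq_on_partial (W : normedModType R) (f g : point -> W) m i :
  U m -> (forall m', U m' -> f m' = g m') -> partial i f m = partial i g m.
Proof. by move=> Um fg; apply: near_eq_derive; exact: eq_on_near. Qed.

(** Differentiability only depends on the germ at m, so that a smooth function
    may be replaced by a formula for it that is valid on U only. *)
Lemma eq_on_differentiable (W : normedModType R) (f g : point -> W) m :
  U m -> (forall m', U m' -> f m' = g m') ->
  differentiable f m -> differentiable g m.
Proof.
move=> Um fg df; have fgm := fg _ Um.
have cdf : continuous ('d f m) by exact: diff_continuous.
have gE : g \o shift m = cst (g m) + 'd f m +o_ (0 : point) id.
  apply/eqaddoP => e e0.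
  have /eqaddoP /(_ e e0) := diff_locally df.
  have : \forall h \near (0 : point), U (h + m).
    have : \forall h \near (m : point), U h by exact: open_nbhs_nbhs.
    by rewrite (near_shift 0 m) subr0; exact: filterS.
  apply: filterS2 => h Uh.
  by rewrite !fctE /= -fgm (fg (h + m)).
have dgE : 'd g m = 'd f m :> (_ -> _) by exact: diff_unique.
by apply/diff_locallyP; rewrite dgE.
Qed.

Lemma smooth_on_cst (W : normedModType R) (w : W) :
  smooth_on U (fun=> w : W).
Proof.
move=> s m Um.
have : exists w', foldr (@partial R n W) (fun=> w) s = fun=> w'.
  elim: s => [|i s [w' IH]] /=; first by exists w.
  by exists 0; rewrite IH; apply/funext => m'; exact: derive_cst.
by move=> [w' ->].
Qed.

(** Keeping the list of differentiations sorted gives equal mixed derivatives a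
    single name. *)
Fixpoint insert_sorted (i : 'I_n.+1) (s : seq 'I_n.+1) : seq 'I_n.+1 :=
  if s is j :: s' then
    if (i <= j)%N then i :: s else j :: insert_sorted i s'
  else [:: i].

Lemma partial_insert (f : point -> R) i s m : smooth_on U f -> U m ->
  partial i (foldr (@partial R n R) f s) m =
  foldr (@partial R n R) f (insert_sorted i s) m.
Proof.
move=> sf; elim: s m => [//|j s IH] m Um /=; case: ifP => //= _.
rewrite (partialC oU Um) //; last 1 first.
- exact: (sf (j :: s)).
- by apply: eq_on_partial => //; exact: IH.
- by move=> m' Um'; exact: (sf s).
exact: (sf (i :: s)).
Qed.

End OnOpen.

(** * Formal differential polynomials *)

(** Polynomials in the atoms A over the rationals, [DQ n k] standing for n / k.
    Once the derivatives of the atoms are given as polynomials in the atoms,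
    differentiation becomes a computation ([dder]); as the constructor [D0] is
    recognized by the operations below, the results stay small. *)
Inductive dpoly (A : Type) : Type :=
  | D0
  | DN of nat
  | DQ of nat & nat
  | DA of A
  | DOpp of dpoly A
  | DAdd of dpoly A & dpoly A
  | DMul of dpoly A & dpoly A.
Arguments D0 {A}.
Arguments DN {A}.
Arguments DQ {A}.

Section DPoly.
Variables (A D : Type) (d : D -> A -> dpoly A).
Implicit Types e : dpoly A.

Definition dpadd e1 e2 :=
  match e1, e2 with D0, _ => e2 | _, D0 => e1 | _, _ => DAdd e1 e2 end.
Definition dpmul e1 e2 :=
  match e1, e2 with D0, _ | _, D0 => D0 | _, _ => DMul e1 e2 end.
Definition dpopp e := if e is D0 then D0 else DOpp e.

Fixpoint dder i e : dpoly A :=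
  match e with
  | D0 | DN _ | DQ _ _ => D0
  | DA a => d i a
  | DOpp e => dpopp (dder i e)
  | DAdd e1 e2 => dpadd (dder i e1) (dder i e2)
  | DMul e1 e2 => dpadd (dpmul (dder i e1) e2) (dpmul e1 (dder i e2))
  end.

Fixpoint deval (R : fieldType) (v : A -> R) e : R :=
  match e with
  | D0 => 0
  | DN n => n%:R
  | DQ n k => n%:R / k%:R
  | DA a => v a
  | DOpp e => - deval v e
  | DAdd e1 e2 => deval v e1 + deval v e2
  | DMul e1 e2 => deval v e1 * deval v e2
  end.

Lemma deval_add (R : fieldType) (v : A -> R) e1 e2 :
  deval v (dpadd e1 e2) = deval v e1 + deval v e2.
Proof. by case: e1 => *; case: e2 => * //=; rewrite ?add0r ?addr0. Qed.

Lemma deval_mul (R : fieldType) (v : A -> R) e1 e2 :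
  deval v (dpmul e1 e2) = deval v e1 * deval v e2.
Proof. by case: e1 => *; case: e2 => * //=; rewrite ?mul0r ?mulr0. Qed.

Lemma deval_opp (R : fieldType) (v : A -> R) e :
  deval v (dpopp e) = - deval v e.
Proof. by case: e => * //=; rewrite oppr0. Qed.

End DPoly.

Declare Scope dpoly_scope.
Delimit Scope dpoly_scope with D.
Bind Scope dpoly_scope with dpoly.
Notation "x + y" := (dpadd x y) : dpoly_scope.
Notation "x * y" := (dpmul x y) : dpoly_scope.
Notation "- x" := (dpopp x) : dpoly_scope.
Notation "x - y" := (dpadd x (dpopp y)) : dpoly_scope.

Section DifferentialField.
Variables (R : realType) (n : nat) (U : set 'rV[R]_n.+1).
Hypothesis oU : open U.
Local Notation point := 'rV[R]_n.+1.
Variables (A : Type) (d : 'I_n.+1 -> A -> dpoly A) (at_ : point -> A -> R).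
Hypothesis at_diff : forall a m, U m -> differentiable (at_ ^~ a) m.
Hypothesis at_der : forall a m i, U m ->
  partial i (at_ ^~ a) m = deval (at_ m) (d i a).
Local Notation fn e := (fun m => deval (at_ m) e).

Lemma deval_differentiable e m : U m -> differentiable (fn e) m.
Proof.
move=> Um; elim: e => [|k|k l|a|e IH|e1 IH1 e2 IH2|e1 IH1 e2 IH2] /=.
- exact: differentiable_cst.
- exact: differentiable_cst.
- exact: differentiable_cst.
- exact: at_diff.
- exact: differentiableN.
- exact: differentiableD.
- exact: differentiableM.
Qed.

Lemma partial_deval e m i : U m ->
  partial i (fn e) m = deval (at_ m) (dder d i e).
Proof.
move=> Um; have D f : derivable (fn f) m (delta_mx 0 i).
  by apply: diff_derivable; exact: deval_differentiable.
elim: e => [|k|k l|a|e IH|e1 IH1 e2 IH2|e1 IH1 e2 IH2] /=.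
- exact: derive_cst.
- exact: derive_cst.
- exact: derive_cst.
- exact: at_der.
- by rewrite deval_opp -IH; exact: deriveN.
- by rewrite deval_add -IH1 -IH2; exact: deriveD.
- rewrite deval_add !deval_mul -IH1 -IH2 addrC [X in _ + X]mulrC.
  exact: (deriveM (D e1) (D e2)).
Qed.

(** A family of functions closed under differentiation consists of smooth
    functions: an iterated derivative is again a polynomial in the family. *)
Lemma smooth_on_deval e : smooth_on U (fn e).
Proof.
move=> s m Um.
apply: (@eq_on_differentiable _ _ _ oU _ (fn (foldr (dder d) e s))) => //;
  last exact: deval_differentiable.
elim: s => //= i s IH m' Um'.
by rewrite -partial_deval //; apply: (eq_on_partial oU).
Qed.

(** Differential consequences of an equation that holds on the open set U. *)
Lemma dder_vanish e : (forall m, U m -> deval (at_ m) e = 0) ->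
  forall i m, U m -> deval (at_ m) (dder d i e) = 0.
Proof.
move=> e0 i m Um; rewrite -partial_deval //.
by rewrite (eq_on_partial oU (g := fun=> 0)) //; exact: derive_cst.
Qed.

End DifferentialField.

Section Inverse.
Variables (R : realType) (n : nat) (U : set 'rV[R]_n.+1).
Hypothesis oU : open U.

(** The atoms are the iterated partial derivatives of f, and [None] for 1 / f. *)
Definition inv_rules (i : 'I_n.+1) (a : option (seq 'I_n.+1)) :=
  if a is Some s then DA (Some (i :: s))
  else (- (DA None * DA None * DA (Some [:: i])))%D.

Lemma smooth_on_inv (f : 'rV[R]_n.+1 -> R) : smooth_on U f ->
  (forall m, U m -> f m != 0) -> smooth_on U (fun m => (f m)^-1).
Proof.
move=> sf f0.
pose at_ m a : R := if a is Some s then foldr (@partial R n R) f s m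
                   else (f m)^-1.
have at_diff a m : U m -> differentiable (at_ ^~ a) m.
  case: a => [s|] Um; first exact: sf.
  by apply: differentiableV; [exact: (sf [::])|exact: f0].
apply: (smooth_on_deval oU (d := inv_rules) at_diff _ (DA None)).
case=> [s|] m i Um //=.
have df : derivable f m (delta_mx 0 i) by apply: diff_derivable; exact: (sf [::]).
have := deriveV (f0 m Um) df; rewrite /partial => ->.
by rewrite expr2 invfM [LHS]mulNr.
Qed.

End Inverse.

(** * The metric g_I in terms of jets *)

Lemma ord5_ind (P : 'I_5 -> Prop) :
  P ix -> P iy -> P ip -> P iq -> P iz -> forall i, P i.
Proof.
move=> Px Py Pp Pq Pz [[|[|[|[|[|//]]]]] i5].
- by rewrite (_ : Ordinal i5 = ix) //; exact: val_inj.
- by rewrite (_ : Ordinal i5 = iy) //; exact: val_inj.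
- by rewrite (_ : Ordinal i5 = ip) //; exact: val_inj.
- by rewrite (_ : Ordinal i5 = iq) //; exact: val_inj.
- by rewrite (_ : Ordinal i5 = iz) //; exact: val_inj.
Qed.

Lemma sum5 (V : nmodType) (F : 'I_5 -> V) :
  \sum_i F i = F ix + F iy + F ip + F iq + F iz.
Proof.
rewrite !big_ord_recr big_ord0 /= add0r.
by do ![congr (_ + _)]; congr F; exact: val_inj.
Qed.

Definition dsum5 (A : Type) (F : 'I_5 -> dpoly A) : dpoly A :=
  (F ix + F iy + F ip + F iq + F iz)%D.

Lemma deval_dsum5 (K : fieldType) (A : Type) (v : A -> K) (F : 'I_5 -> dpoly A) :
  deval v (dsum5 F) = \sum_i deval v (F i).
Proof. by rewrite sum5 /dsum5 !deval_add. Qed.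

(** Coordinates, derivatives of I at x, partial derivatives of sigma, and
    Omega = 1 / sigma. *)
Inductive jet : Type :=
  JX of 'I_5 | JI of nat | JS of seq 'I_5 | JO.

Notation jx i := (DA (JX i)).
Notation jI k := (DA (JI k)).
Notation js s := (DA (JS s)).
Notation jO := (DA JO).

Definition jet_rules (i : 'I_5) (a : jet) : dpoly jet :=
  match a with
  | JX j => if (i : nat) == j then DN 1 else D0
  | JI k => if (i : nat) is 0%N then jI k.+1 else D0
  | JS s => js (insert_sorted i s)
  | JO => (- (jO * jO * js [:: i]))%D
  end.
Notation jder := (dder jet_rules).

(** The components of g_I, and below those of its inverse and its Christoffel
    symbols, the coordinates x, y, p, q, z being numbered from 0 to 4. *)
Definition g0E (i j : 'I_5) : dpoly jet :=
  match (i : nat), (j : nat) with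
  | 0, 0 => (DN 2 * jI 0 * jx ip * jx ip - DQ 3 2 * jI 0 * jI 0 * jx iy * jx iy
            + DQ 3 2 * jI 2 * jx iy * jx iy - DQ 3 2 * jx iy * jx iy
            - DQ 1 2 * jx iq * jx iq)%D
  | 0, 1 => (- (DN 2 * jI 0 * jx ip))%D
  | 0, 2 => (DQ 1 2 * jx iq)%D
  | 0, 3 => (- (DQ 3 2 * jx ip))%D
  | 0, 4 => (- (DQ 3 2))%D
  | 1, 0 => (- (DN 2 * jI 0 * jx ip))%D
  | 1, 1 => (- (DN 3 * jI 0))%D
  | 1, 3 => (DQ 3 2)%D
  | 2, 0 => (DQ 1 2 * jx iq)%D
  | 2, 2 => (- (DN 2))%D
  | 3, 0 => (- (DQ 3 2 * jx ip))%D
  | 3, 1 => (DQ 3 2)%D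
  | 4, 0 => (- (DQ 3 2))%D
  | _, _ => D0
  end%N.

Definition g0invE (i j : 'I_5) : dpoly jet :=
  match (i : nat), (j : nat) with
  | 0, 4 => (- (DQ 2 3))%D
  | 1, 3 => (DQ 2 3)%D
  | 1, 4 => (- (DQ 2 3 * jx ip))%D
  | 2, 2 => (- (DQ 1 2))%D
  | 2, 4 => (- (DQ 1 6 * jx iq))%D
  | 3, 1 => (DQ 2 3)%D
  | 3, 3 => (DQ 4 3 * jI 0)%D
  | 3, 4 => (- (DQ 20 9 * jI 0 * jx ip))%D
  | 4, 0 => (- (DQ 2 3))%D
  | 4, 1 => (- (DQ 2 3 * jx ip))%D
  | 4, 2 => (- (DQ 1 6 * jx iq))%D
  | 4, 3 => (- (DQ 20 9 * jI 0 * jx ip))%D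
  | 4, 4 => (DQ 20 9 * jI 0 * jx ip * jx ip + DQ 2 3 * jI 0 * jI 0 * jx iy * jx iy
            - DQ 2 3 * jI 2 * jx iy * jx iy + DQ 2 3 * jx iy * jx iy
            + DQ 1 6 * jx iq * jx iq)%D
  | _, _ => D0
  end%N.

Definition christoffel0E (k i j : 'I_5) : dpoly jet :=
  match (k : nat), (i : nat), (j : nat) with
  | 1, 0, 0 => (DQ 1 3 * jx iq)%D
  | 1, 0, 2 => (- (DQ 2 3))%D
  | 1, 2, 0 => (- (DQ 2 3))%D
  | 2, 0, 0 => (jI 0 * jx ip)%D
  | 2, 0, 1 => (- (DQ 1 2 * jI 0))%D
  | 2, 0, 3 => (- (DQ 1 2))%D
  | 2, 1, 0 => (- (DQ 1 2 * jI 0))%D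
  | 2, 3, 0 => (- (DQ 1 2))%D
  | 3, 0, 0 => (DQ 2 3 * jI 0 * jx iq + jI 0 * jI 0 * jx iy - DQ 4 3 * jI 1 * jx ip
            - jI 2 * jx iy + jx iy)%D
  | 3, 0, 1 => (- (jI 1))%D
  | 3, 0, 2 => (- (DN 2 * jI 0))%D
  | 3, 1, 0 => (- (jI 1))%D
  | 3, 2, 0 => (- (DN 2 * jI 0))%D
  | 4, 0, 0 => (jI 0 * jI 1 * jx iy * jx iy - DQ 7 9 * jI 0 * jx ip * jx iq
            - jI 0 * jI 0 * jx iy * jx ip + DQ 2 3 * jI 1 * jx ip * jx ip
            + jI 2 * jx iy * jx ip - DQ 1 2 * jI 3 * jx iy * jx iy - jx iy * jx ip)%D
  | 4, 0, 1 => (- (DQ 1 6 * jI 0 * jx iq) + jI 0 * jI 0 * jx iy + jI 1 * jx ip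
            - jI 2 * jx iy + jx iy)%D
  | 4, 0, 2 => (DQ 14 9 * jI 0 * jx ip)%D
  | 4, 0, 3 => (DQ 1 6 * jx iq)%D
  | 4, 1, 0 => (- (DQ 1 6 * jI 0 * jx iq) + jI 0 * jI 0 * jx iy + jI 1 * jx ip
            - jI 2 * jx iy + jx iy)%D
  | 4, 1, 1 => (- (jI 1))%D
  | 4, 1, 2 => (DQ 2 3 * jI 0)%D
  | 4, 2, 0 => (DQ 14 9 * jI 0 * jx ip)%D
  | 4, 2, 1 => (DQ 2 3 * jI 0)%D
  | 4, 2, 3 => (DQ 1 3)%D
  | 4, 3, 0 => (DQ 1 6 * jx iq)%D
  | 4, 3, 2 => (DQ 1 3)%D
  | _, _, _ => D0
  end%N.

Section Jets.
Variables (R : realType) (J : set R) (I : R -> R) (sigma : 'rV[R]_5 -> R).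
Hypotheses (oJ : open J) (I_smooth : smooth1_on J I).
Hypotheses (sigma_smooth : smooth_on (MI J) sigma)
  (sigma0 : forall m, MI J m -> sigma m != 0).

Lemma open_MI : open (MI J).
Proof.
rewrite /MI; apply: (@open_comp _ _ (fun m : 'rV[R]_5 => m 0 ix) J) => //.
by move=> m _; exact: coord_continuous.
Qed.

Definition jetval (m : 'rV[R]_5) (a : jet) : R :=
  match a with
  | JX i => m 0 i
  | JI k => derive1n k I (m 0 ix)
  | JS s => foldr (@partial R 4 R) sigma s m
  | JO => (sigma m)^-1
  end.
Local Notation ev m := (deval (jetval m)).

Lemma partial_coord (h : R -> R) (j i : 'I_5) (m : 'rV[R]_5) :
  derivable h (m 0 j) 1 ->
  differentiable (fun m' : 'rV[R]_5 => h (m' 0 j)) m /\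
  partial i (fun m' : 'rV[R]_5 => h (m' 0 j)) m = (i == j)%:R * derive1 h (m 0 j).
Proof.
move=> dh.
have dc : differentiable (fun m' : 'rV[R]_5 => m' 0 j) m.
  exact: differentiable_coord.
have dh' : differentiable h (m 0 j) by apply/derivable1_diffP.
have dhc : differentiable (h \o fun m' : 'rV[R]_5 => m' 0 j) m.
  exact: differentiable_comp.
split=> //.
rewrite /partial deriveE // (diff_comp dc dh') /=.
have -> : 'd (fun m' : 'rV[R]_5 => m' 0 j) m (delta_mx 0 i) = (i == j)%:R.
  rewrite -deriveE //.
  have did : derivable (@id 'rV[R]_5) m (delta_mx 0 i) by exact: derivable_id.
  have := derive_mx did.
  move=> /matrixP /(_ 0 j); rewrite derive_id !mxE /= eq_sym => <-.
  by [].
by have := congr1 (@^~ (i == j)%:R) (deriv1E dh).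
Qed.

Lemma jetval_diff a m : MI J m -> differentiable (jetval ^~ a) m.
Proof.
move=> Um; case: a => [i|k|s|] /=.
- exact: differentiable_coord.
- by have [] := @partial_coord (derive1n k I) ix ix m (@I_smooth k _ Um).
- exact: sigma_smooth.
- by apply: differentiableV; [exact: (@sigma_smooth [::] m Um)|exact: sigma0].
Qed.

Lemma jetval_der a m i : MI J m ->
  partial i (jetval ^~ a) m = ev m (jet_rules i a).
Proof.
move=> Um; case: a => [j|k|s|] /=.
- have [|_ ->] := @partial_coord id j i m; first exact: derivable_id.
  by rewrite derive1_id mulr1; case: ifP => /= [/eqP/val_inj -> |/negP ij];
     rewrite ?eqxx //; case: eqP => // ji; case: ij; rewrite ji.
- have [_ ->] := @partial_coord (derive1n k I) ix i m (@I_smooth k _ Um).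
  by move: i; apply: ord5_ind => /=; rewrite ?mul0r ?mul1r.
- exact: (partial_insert open_MI).
- have ds : derivable sigma m (delta_mx 0 i).
    by apply: diff_derivable; exact: (@sigma_smooth [::] m Um).
  have := deriveV (sigma0 Um) ds; rewrite {1}/partial => ->.
  by rewrite expr2 invfM [LHS]mulNr.
Qed.

Definition FE : dpoly jet :=
  (- (DQ 1 2 * (jx iq * jx iq + DQ 10 3 * jI 0 * jx ip * jx ip
    + (DN 1 + jI 0 * jI 0 - jI 2) * jx iy * jx iy)))%D.

Lemma FI_jet m : FI I m = ev m FE.
Proof. by rewrite /FI /=; field. Qed.

Lemma partial_FI m : MI J m -> partial iq (FI I) m = - m 0 iq.
Proof.
move=> Um.
rewrite (eq_on_partial open_MI (g := fun m => ev m FE)) //; last first.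
  by move=> m' _; exact: FI_jet.
rewrite (partial_deval _ jetval_der) //; last exact: jetval_diff.
by rewrite /=; field.
Qed.

Lemma sym_prodE (a b : 'rV[R]_5) i j :
  sym_prod a b i j = 2^-1 * (a 0 i * b 0 j + b 0 i * a 0 j).
Proof. by rewrite /sym_prod !mxE !big_ord1 !mxE. Qed.

Lemma gI_jet m i j : MI J m -> gI I m i j = ev m (g0E i j).
Proof.
move=> Um.
rewrite /gI.
have := sym_prodE (omega1 m) (omega1 m) i j.
have := sym_prodE (omega1 m) (omega4 m) i j.
have := sym_prodE (omega1 m) (omega5 m) i j.
have := sym_prodE (omega2 I m) (omega5 m) i j.
have := sym_prodE (omega3 m) (omega3 m) i j.
move: (sym_prod (omega1 m) (omega1 m)) (sym_prod (omega1 m) (omega4 m))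
  (sym_prod (omega1 m) (omega5 m)) (sym_prod (omega2 I m) (omega5 m))
  (sym_prod (omega3 m) (omega3 m)) => S11 S14 S15 S25 S33 E33 E25 E15 E14 E11.
rewrite !mxE E33 E25 E15 E14 E11 {S11 S14 S15 S25 S33 E33 E25 E15 E14 E11}.
rewrite /omega1 /omega2 /omega3 /omega4 /omega5 /dcoord partial_FI // FI_jet.
rewrite !mxE.
move: i j; apply: ord5_ind; apply: ord5_ind; by rewrite /=; field.
Qed.

End Jets.

(** * Ricci curvature of a conformal metric *)

Definition gE i j : dpoly jet := (jO * jO * g0E i j)%D.
Definition ginvE i j : dpoly jet := (js [::] * js [::] * g0invE i j)%D.

Definition deltaE (i j : 'I_5) : dpoly jet :=
  if (i : nat) == j then DN 1 else D0.

(** The gradient of sigma with respect to g_I. *)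
Definition gradE k : dpoly jet := dsum5 (fun l => g0invE k l * js [:: l])%D.

(** The conformal transformation law of the Christoffel symbols, with
    d (log Omega) = - Omega d sigma. *)
Definition christoffelE k i j : dpoly jet :=
  (christoffel0E k i j - jO * (deltaE k i * js [:: j] + deltaE k j * js [:: i]
     - g0E i j * gradE k))%D.

Definition christoffel_defE k i j : dpoly jet :=
  (DQ 1 2 * dsum5 (fun l => ginvE k l *
    (jder i (gE j l) + jder j (gE i l) - jder l (gE i j))))%D.

Definition ricciE k j : dpoly jet :=
  dsum5 (fun i => jder i (christoffelE i j k) - jder j (christoffelE i i k)
   + dsum5 (fun a => christoffelE i i a * christoffelE a j k
                   - christoffelE i j a * christoffelE a i k))%D.

Definition hessE i j : dpoly jet :=
  (js (insert_sorted i [:: j]) - dsum5 (fun k => christoffel0E k i j * js [:: k]))%D.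

(** The Laplacian of sigma minus 4 Omega |d sigma|^2, with respect to g_I. *)
Definition muE : dpoly jet :=
  (dsum5 (fun i => dsum5 (fun j =>
    g0invE i j * (hessE i j - DN 4 * jO * js [:: i] * js [:: j]))))%D.

(** The Ricci tensor of g_I, that is - I dx^2. *)
Definition ricci0E (i j : 'I_5) : dpoly jet :=
  if (i : nat) is 0%N then if (j : nat) is 0%N then (- jI 0)%D else D0 else D0.

(** Evaluates both polynomials by the virtual machine before unfolding [deval],
    which leaves an identity between values of atoms. *)
Ltac dpoly_compute := match goal with |- deval ?v ?e1 = deval ?v ?e2 =>
  let e1' := eval vm_compute in e1 in
  let e2' := eval vm_compute in e2 in
  transitivity (deval v e1');
    [apply: congr1; vm_cast_no_check (erefl e1')|];
  transitivity (deval v e2'); last (apply: congr1; vm_cast_no_check (erefl e2'));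
  cbn [deval] end.

Section Ric.
Variables (R : realType) (J : set R) (I : R -> R) (sigma : 'rV[R]_5 -> R).
Hypotheses (oJ : open J) (I_smooth : smooth1_on J I).
Hypotheses (sigma_smooth : smooth_on (MI J) sigma)
  (sigma0 : forall m, MI J m -> sigma m != 0).
Variable g : 'rV[R]_5 -> 'M[R]_5.
Hypothesis gE0 : forall m, MI J m -> g m = (sigma m)^-1 ^+ 2 *: gI I m.
Local Notation jetval := (jetval I sigma).
Local Notation ev m := (deval (jetval m)).

Lemma g_jet m i j : MI J m -> g m i j = ev m (gE i j).
Proof.
move=> Um; rewrite gE0 // mxE (gI_jet oJ I_smooth sigma_smooth sigma0) // /gE deval_mul.
by rewrite deval_mul expr2.
Qed.

Lemma ginv_mul m : MI J m -> (\matrix_(i, j) ev m (ginvE i j)) *m g m = 1%:M.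
Proof.
move=> Um; have s0 := sigma0 Um.
apply/matrixP => i j; rewrite !mxE sum5 !mxE !g_jet //.
by move: i j; apply: ord5_ind; apply: ord5_ind; by rewrite /=; field.
Qed.

Lemma g_inv m : MI J m -> invmx (g m) = \matrix_(i, j) ev m (ginvE i j).
Proof.
move=> Um; have gg := ginv_mul Um; have gu : g m \in unitmx by case: (mulmx1_unit gg).
by rewrite -[RHS](mulmxK gu) gg mul1mx.
Qed.

Lemma partial_g m i j l : MI J m ->
  partial i (fun m' => g m' j l) m = ev m (jder i (gE j l)).
Proof.
move=> Um.
rewrite -(partial_deval (jetval_diff I_smooth sigma_smooth sigma0)
  (jetval_der oJ I_smooth sigma_smooth sigma0)) //.
by apply: (eq_on_partial (open_MI oJ)) => // m' Um'; exact: g_jet.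
Qed.

(** This validates at once the table of Christoffel symbols of g_I and the
    conformal transformation law. *)
Lemma christoffel_jet m k i j : MI J m ->
  christoffel g k i j m = ev m (christoffelE k i j).
Proof.
move=> Um; have s0 := sigma0 Um.
have -> : christoffel g k i j m = ev m (christoffel_defE k i j).
  rewrite /christoffel /christoffel_defE deval_mul deval_dsum5 /= mul1r.
  congr (_ * _); apply: eq_bigr => l _.
  rewrite g_inv // mxE !partial_g // deval_mul !deval_add deval_opp //.
have vO : jetval m JO = (jetval m (JS [::]))^-1 by [].
have v0 : jetval m (JS [::]) != 0 by [].
move: (jetval m) vO v0 => v vO v0 {Um s0}.
move: k i j; do 3! apply: ord5_ind; dpoly_compute; rewrite ?vO; by field.
Qed.

Lemma partial_christoffel m k i j l : MI J m ->
  partial l (christoffel g k i j) m = ev m (jder l (christoffelE k i j)).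
Proof.
move=> Um.
rewrite -(partial_deval (jetval_diff I_smooth sigma_smooth sigma0)
  (jetval_der oJ I_smooth sigma_smooth sigma0)) //.
by apply: (eq_on_partial (open_MI oJ)) => // m' Um'; exact: christoffel_jet.
Qed.

Lemma ricci_jet m k j : MI J m -> ricci g k j m = ev m (ricciE k j).
Proof.
move=> Um; rewrite /ricci /ricciE deval_dsum5; apply: eq_bigr => i _.
rewrite /riemann deval_add deval_dsum5 [X in _ = X + _]deval_add deval_opp.
rewrite !partial_christoffel //; congr (_ + _); apply: eq_bigr => a _.
by rewrite !deval_add deval_opp !deval_mul !christoffel_jet.
Qed.

Lemma ricci_conformal m k j : MI J m ->
  ricci g k j m = ev m (ricci0E k j + jO * (DN 3 * hessE k j + muE * g0E k j))%D.
Proof.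
move=> Um; rewrite ricci_jet //.
move: (jetval m) => v {Um}.
move: k j; apply: ord5_ind; apply: ord5_ind; dpoly_compute; by field.
Qed.

End Ric.

(** * The Einstein equation for the conformal factor *)

Section Vanishing.
Variables (R : fieldType) (A : Type) (v : A -> R).
Implicit Types e : dpoly A.

Lemma vanishD e1 e2 : deval v e1 = 0 -> deval v e2 = 0 -> deval v (e1 + e2)%D = 0.
Proof. by move=> e10 e20; rewrite deval_add e10 e20 addr0. Qed.

Lemma vanishB e1 e2 : deval v e1 = 0 -> deval v e2 = 0 -> deval v (e1 - e2)%D = 0.
Proof. by move=> e10 e20; rewrite deval_add deval_opp e10 e20 subr0. Qed.

Lemma vanishM e1 e2 : deval v e2 = 0 -> deval v (e1 * e2)%D = 0.
Proof. by move=> e20; rewrite deval_mul e20 mulr0. Qed.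

End Vanishing.

Definition einsteinE i j : dpoly jet :=
  (js [::] * ricci0E i j + DN 3 * hessE i j + DN 2 * js [:: ix; iz] * g0E i j)%D.

Section Deduce.
Variables (R : realType) (J : set R) (I : R -> R) (sigma : 'rV[R]_5 -> R).
Hypotheses (oJ : open J) (I_smooth : smooth1_on J I).
Hypotheses (sigma_smooth : smooth_on (MI J) sigma)
  (sigma0 : forall m, MI J m -> sigma m != 0).
Variable g : 'rV[R]_5 -> 'M[R]_5.
Hypothesis gE0 : forall m, MI J m -> g m = (sigma m)^-1 ^+ 2 *: gI I m.
Hypothesis flat : ricci_flat_on (MI J) g.
Local Notation jetval := (jetval I sigma).
Local Notation ev m := (deval (jetval m)).

(** The (x, z) component of g_I is - 3/2, that of its Ricci tensor is 0, and the
    Hessian of sigma has there the component sigma_xz; so the coefficient of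
    g_I in the Ricci-flat condition is 2 sigma_xz. *)
Lemma einstein_eq i j m : MI J m -> ev m (einsteinE i j) = 0.
Proof.
move=> Um; have s0 := sigma0 Um.
have F k l : sigma m * ev m (ricci0E k l)
    + (3 * ev m (hessE k l) + ev m muE * ev m (g0E k l)) = 0.
  have := flat Um k l.
  rewrite (ricci_conformal oJ I_smooth sigma_smooth sigma0 gE0) //.
  rewrite deval_add deval_mul deval_add !deval_mul.
  move=> /(congr1 (fun r => sigma m * r)).
  by rewrite mulr0 mulrDr mulVKf.
have mu2 : ev m muE = 2 * ev m (js [:: ix; iz]).
  have h : ev m (hessE ix iz) = ev m (js [:: ix; iz]) by dpoly_compute; ring.
  have := F ix iz; rewrite h [ev m (ricci0E _ _)]/= [ev m (g0E _ _)]/=.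
  by move: (ev m muE) (ev m _) => a b ab; lra.
rewrite /einsteinE deval_add deval_add !deval_mul.
by rewrite -[RHS](F i j) mu2 addrA.
Qed.

Lemma jet_der_vanish e i : (forall m, MI J m -> ev m e = 0) ->
  forall m, MI J m -> ev m (jder i e) = 0.
Proof.
move=> e0 m Um; apply: (dder_vanish (open_MI oJ)
  (jetval_diff I_smooth sigma_smooth sigma0)
  (jetval_der oJ I_smooth sigma_smooth sigma0) e0) => //.
Qed.

(* Among the components of g_I with index z, only the (x, z) one is nonzero. *)
Let sz_vanish i m : MI J m -> i != ix -> ev m (js (insert_sorted i [:: iz])) = 0.
Proof.
move=> Um ix0.
have -> : ev m (js (insert_sorted i [:: iz])) = ev m (DQ 1 3 * einsteinE i iz)%D.
  move: i ix0; apply: ord5_ind => // _; dpoly_compute; by field.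
by rewrite deval_mul einstein_eq // mulr0.
Qed.

(** The derivative in x of the (y, y) equation and the derivative in y of the
    (x, y) equation both contain sigma_xyy.  The other derivatives of order two
    and three in their difference are removed by further consequences of the
    system, which leaves 3 sigma_z. *)
Lemma sigma_z0 m : MI J m -> partial iz sigma m = 0.
Proof.
move=> Um.
have zz i : i != ix -> forall m, MI J m -> ev m (js (insert_sorted i [:: iz])) = 0.
  by move=> ? ? ?; exact: sz_vanish.
have zy := zz iy isT m Um; have zp := zz ip isT m Um.
have zq := zz iq isT m Um; have zzz := zz iz isT m Um.
have zxy := jet_der_vanish ix (zz iy isT) Um.
have zxz := jet_der_vanish ix (zz iz isT) Um.
have E1 := jet_der_vanish ix (einstein_eq iy iy) Um.
have E2 := jet_der_vanish iy (einstein_eq ix iy) Um.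
have E3 := jet_der_vanish iz (einstein_eq ix ix) Um.
have E4 := einstein_eq iy ip Um.
have E5 := einstein_eq iy iq Um.
(* The multipliers are those that cancel all derivatives of sigma of order two
   and three. *)
have := vanishD (vanishD (vanishD (vanishB E1 E2)
  (vanishM (DN 2 * jI 0)%D E3)) (vanishM (DQ 1 2 * jI 0)%D E4))
  (vanishM (jI 1) E5).
rewrite -[partial iz sigma m]/(ev m (js [:: iz])).
move: zy zp zq zzz zxy zxz; move: (jetval m) => v zy zp zq zzz zxy zxz.
rewrite /= in zy zp zq zzz zxy zxz.
set e := (X in deval v X); have -> : deval v e = deval v (DN 3 * js [:: iz])%D.
  by dpoly_compute; rewrite !(zy, zp, zq, zzz, zxy, zxz); field.
rewrite deval_mul /= => /eqP; rewrite mulf_eq0 => /orP[|/eqP//].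
by rewrite pnatr_eq0.
Qed.

Let dz_vanish i m : MI J m -> ev m (js (insert_sorted i [:: iz])) = 0.
Proof. by apply: (jet_der_vanish i (e := js [:: iz])) => //; exact: sigma_z0. Qed.

(** The same compatibility argument between the (x, y) and (x, x) equations,
    once the derivatives of sigma in z are known to vanish, leaves 3 sigma_q. *)
Lemma sigma_q0 m : MI J m -> partial iq sigma m = 0.
Proof.
move=> Um.
have z := sigma_z0 Um.
rewrite -[partial iz sigma m]/(ev m (js [:: iz])) in z.
have zx := dz_vanish ix Um; have zy := dz_vanish iy Um.
have zp := dz_vanish ip Um; have zq := dz_vanish iq Um.
have zxx := jet_der_vanish ix (fun m => dz_vanish ix (m := m)) Um.
have zxy := jet_der_vanish ix (fun m => dz_vanish iy (m := m)) Um.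
have E1 := jet_der_vanish ix (einstein_eq ix iy) Um.
have E2 := jet_der_vanish iy (einstein_eq ix ix) Um.
have E3 := einstein_eq ix ip Um.
have E4 := einstein_eq ix iq Um.
have E5 := einstein_eq iy ip Um.
have E6 := einstein_eq iy iq Um.
have E7 := einstein_eq iy iy Um.
have := vanishB (vanishB (vanishB (vanishB (vanishB (vanishB E1 E2)
  (vanishM (DQ 1 2 * jI 0)%D E3)) (vanishM (jI 1) E4))
  (vanishM (jI 0 * jx ip)%D E5)) (vanishM (DQ 2 3 * jI 0 * jx iq +
    jI 0 * jI 0 * jx iy - DQ 4 3 * jI 1 * jx ip - jI 2 * jx iy + jx iy)%D E6))
  (vanishM (DQ 1 3 * jx iq)%D E7).
rewrite -[partial iq sigma m]/(ev m (js [:: iq])).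
move: z zx zy zp zq zxx zxy; move: (jetval m) => v z zx zy zp zq zxx zxy.
rewrite /= in z zx zy zp zq zxx zxy.
set e := (X in deval v X); have -> : deval v e = deval v (DN 3 * js [:: iq])%D.
  by dpoly_compute; rewrite !(z, zx, zy, zp, zq, zxx, zxy); field.
rewrite deval_mul /= => /eqP; rewrite mulf_eq0 => /orP[|/eqP//].
by rewrite pnatr_eq0.
Qed.

(** Without z and q derivatives, the (x, q) equation amounts to sigma_p = 0; the
    next lemma treats the (x, p) equation and sigma_y in the same way. *)
Lemma sigma_p0 m : MI J m -> partial ip sigma m = 0.
Proof.
move=> Um; have z := sigma_z0 Um; have zx := dz_vanish ix Um.
have qx : ev m (js [:: ix; iq]) = 0.
  by apply: (jet_der_vanish ix (e := js [:: iq])) => //; exact: sigma_q0.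
rewrite -[LHS]/(ev m (js [:: ip])) -(vanishM (DQ 2 3) (einstein_eq ix iq Um)).
rewrite -[partial iz sigma m]/(ev m (js [:: iz])) in z.
move: z zx qx; move: (jetval m) => v z zx qx; rewrite /= in z zx qx.
by dpoly_compute; rewrite !(z, zx, qx); field.
Qed.

Lemma sigma_y0 m : MI J m -> partial iy sigma m = 0.
Proof.
move=> Um; have z := sigma_z0 Um; have zx := dz_vanish ix Um.
have q := sigma_q0 Um.
have px : ev m (js [:: ix; ip]) = 0.
  by apply: (jet_der_vanish ix (e := js [:: ip])) => //; exact: sigma_p0.
rewrite -[LHS]/(ev m (js [:: iy])) -(vanishM (DQ 1 2) (einstein_eq ix ip Um)).
rewrite -[partial iz sigma m]/(ev m (js [:: iz])) in z.
rewrite -[partial iq sigma m]/(ev m (js [:: iq])) in q.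
move: z zx px q; move: (jetval m) => v z zx px q; rewrite /= in z zx px q.
by dpoly_compute; rewrite !(z, zx, px, q); field.
Qed.

Lemma sigma_ode m : MI J m ->
  partial ix (partial ix sigma) m = I (m 0 ix) / 3 * sigma m.
Proof.
move=> Um; have z := sigma_z0 Um; have zx := dz_vanish ix Um.
have q := sigma_q0 Um; have y := sigma_y0 Um; have p := sigma_p0 Um.
have E := vanishM (DQ 1 3) (einstein_eq ix ix Um).
rewrite -[LHS]/(ev m (js [:: ix; ix])).
have -> : I (m 0 ix) / 3 * sigma m = ev m (jI 0 * DQ 1 3 * js [::])%D.
  by rewrite /=; field.
rewrite -[partial iz sigma m]/(ev m (js [:: iz])) in z.
rewrite -[partial iq sigma m]/(ev m (js [:: iq])) in q.
rewrite -[partial iy sigma m]/(ev m (js [:: iy])) in y.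
rewrite -[partial ip sigma m]/(ev m (js [:: ip])) in p.
move: z zx q y p E; move: (jetval m) => v z zx q y p E.
rewrite /= in z zx q y p.
rewrite -[RHS]addr0 -E -deval_add.
by dpoly_compute; rewrite !(z, q, y, p, zx); field.
Qed.

End Deduce.

(** * A coframe with nilpotent connection *)

Section Substitution.
Variables (R : fieldType) (A B : Type).

Fixpoint dsubst (f : A -> dpoly B) (e : dpoly A) : dpoly B :=
  match e with
  | D0 => D0
  | DN n => DN n
  | DQ n k => DQ n k
  | DA a => f a
  | DOpp e => dpopp (dsubst f e)
  | DAdd e1 e2 => dpadd (dsubst f e1) (dsubst f e2)
  | DMul e1 e2 => dpmul (dsubst f e1) (dsubst f e2)
  end.

Fixpoint dall (P : pred A) (e : dpoly A) : bool :=
  match e with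
  | D0 | DN _ | DQ _ _ => true
  | DA a => P a
  | DOpp e => dall P e
  | DAdd e1 e2 | DMul e1 e2 => dall P e1 && dall P e2
  end.

Lemma deval_dsubst (f : A -> dpoly B) (vA : A -> R) (vB : B -> R) (P : pred A) e :
  (forall a, P a -> vA a = deval vB (f a)) -> dall P e ->
  deval vA e = deval vB (dsubst f e).
Proof.
move=> fP; elim: e => //= [e IH|e1 IH1 e2 IH2|e1 IH1 e2 IH2].
- by move=> /IH ->; rewrite deval_opp.
- by move=> /andP[/IH1 -> /IH2 ->]; rewrite deval_add.
- by move=> /andP[/IH1 -> /IH2 ->]; rewrite deval_mul.
Qed.

End Substitution.

(** For a conformal factor that depends on x alone, the jets reduce to the
    coordinates, the derivatives of I, and rho = sigma, rho', 1 / rho and theta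
    as functions of x; they are closed under differentiation because
    rho'' = I rho / 3 and theta' = rho^-2. *)
Inductive fatom : Type := FX of 'I_5 | FInv of nat | Frho | Frho1 | FO | Fth.
Notation fx i := (DA (FX i)).
Notation fI k := (DA (FInv k)).
Notation frho := (DA Frho).
Notation frho1 := (DA Frho1).
Notation fO := (DA FO).
Notation fth := (DA Fth).

Definition frame_rules (i : 'I_5) (a : fatom) : dpoly fatom :=
  match a with
  | FX j => if (i : nat) == j then DN 1 else D0
  | _ => if (i : nat) is 0%N then
      match a with
      | FX _ => D0
      | FInv k => fI k.+1
      | Frho => frho1
      | Frho1 => (DQ 1 3 * fI 0 * frho)%D
      | FO => (- (fO * fO * frho1))%D
      | Fth => (fO * fO)%D
      end else D0
  end.
Notation fder := (dder frame_rules).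

Definition jet_to_frame (a : jet) : dpoly fatom :=
  match a with
  | JX i => fx i
  | JI k => fI k
  | JS [::] => frho
  | JS (i :: _) => if (i : nat) is 0%N then frho1 else D0
  | JO => fO
  end.

Definition first_order (a : jet) : bool :=
  if a is JS s then (size s <= 1)%N else true.

Definition gF i j := dsubst jet_to_frame (gE i j).
Definition ginvF i j := dsubst jet_to_frame (ginvE i j).
Definition christoffelF k i j := dsubst jet_to_frame (christoffelE k i j).

(** The products of two elements of the basis rho, rho theta of solutions of
    u'' = I u / 3. *)
Definition sym_sqF (n : nat) : dpoly fatom :=
  match n with
  | 0 => (frho * frho)%D
  | 1 => (frho * frho * fth)%D
  | _ => (frho * frho * fth * fth)%D
  end%N.

Definition phiF (n : nat) : dpoly fatom :=
  let f := sym_sqF n in let f1 := fder ix f in let f2 := fder ix f1 in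
  (fO * ((DN 3 * f2 - DN 3 * fI 0 * f) * fx iy - DN 2 * f1 * fx ip + f * fx iq))%D.

Definition dphiF (n : nat) (j : 'I_5) : dpoly fatom := fder j (phiF n).

(** The form that completes rho^-2 dx and the d phi_n to a coframe in which g
    has the constant coefficients [pairingF]; u is the logarithmic derivative of
    rho. *)
Definition zetaF (j : 'I_5) : dpoly fatom :=
  let u := (fO * frho1)%D in
  let I0 := fI 0 in let I1 := fI 1 in let I2 := fI 2 in
  let y := fx iy in let p := fx ip in let q := fx iq in
  match (j : nat) with
  | 0 => ((DQ 3 2 * I0 * u * u - DQ 1 2 * I0 * I0 - DQ 3 2 * I1 * u
           + DQ 3 4 * I2 - DQ 3 4) * y * y
          + (u * u - DQ 1 3 * I0) * p * p - I1 * y * p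
          + (DQ 1 2 * I0 - DQ 3 2 * u * u) * y * q)%D
  | 1 => (DQ 3 2 * (I1 - DN 2 * I0 * u) * y - I0 * p + DQ 3 2 * u * q)%D
  | 2 => (- (I0 * y + DN 2 * u * p + DQ 1 2 * q))%D
  | 3 => (DQ 3 2 * u * y - DQ 1 2 * p)%D
  | _ => (- DQ 3 2)%D
  end%N.

Definition coframeF (a j : 'I_5) : dpoly fatom :=
  match (a : nat) with
  | 0 => if (j : nat) is 0%N then (fO * fO)%D else D0
  | n.+1 => if n is 3%N then zetaF j else dphiF n j
  end%N.

Definition rateF (n : nat) : dpoly fatom :=
  (- (fx iy * frho * sym_sqF n))%D.

Definition connectionF (a b : 'I_5) : dpoly fatom :=
  match (a : nat), (b : nat) with
  | 1, 0 => rateF 0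
  | 2, 0 => rateF 1
  | 3, 0 => rateF 2
  | 4, 1 => (- (DQ 1 4 * rateF 2))%D
  | 4, 2 => (DQ 1 2 * rateF 1)%D
  | 4, 3 => (- (DQ 1 4 * rateF 0))%D
  | _, _ => D0
  end%N.

Definition pairingF (a b : 'I_5) : dpoly fatom :=
  match (a : nat), (b : nat) with
  | 0, 4 | 4, 0 => DN 1
  | 1, 3 | 3, 1 => DQ 1 4
  | 2, 2 => (- DQ 1 2)%D
  | _, _ => D0
  end%N.

Section Frame.
Variables (R : realType) (J : set R) (I rho rho1 th : R -> R).
Hypotheses (oJ : open J) (I_smooth : smooth1_on J I).
Hypotheses (rho0 : forall x, J x -> rho x != 0)
  (rho_der : forall x, J x -> is_derive x 1 rho (rho1 x))
  (rho1_der : forall x, J x -> is_derive x 1 rho1 (I x / 3 * rho x))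
  (th_der : forall x, J x -> is_derive x 1 th ((rho x)^-1 ^+ 2)).
Local Notation U := (MI J).

Definition faval (m : 'rV[R]_5) (a : fatom) : R :=
  match a with
  | FX i => m 0 i
  | FInv k => derive1n k I (m 0 ix)
  | Frho => rho (m 0 ix)
  | Frho1 => rho1 (m 0 ix)
  | FO => (rho (m 0 ix))^-1
  | Fth => th (m 0 ix)
  end.
Local Notation ev m := (deval (faval m)).

Let base (h : R -> R) (dh : R) (m : 'rV[R]_5) (i : 'I_5) : is_derive (m 0 ix) 1 h dh ->
  differentiable (fun m' : 'rV[R]_5 => h (m' 0 ix)) m /\
  partial i (fun m' : 'rV[R]_5 => h (m' 0 ix)) m =
    if (i : nat) is 0%N then dh else 0.
Proof.
move=> [hd hE]; have [dd ->] := partial_coord i hd; split => //.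
rewrite derive1E hE.
by move: i; apply: ord5_ind => /=; rewrite ?mul0r ?mul1r.
Qed.

Let inv_der (x : R) : J x -> is_derive x 1 (fun x => (rho x)^-1)
  (- ((rho x)^-1 * (rho x)^-1 * rho1 x)).
Proof.
move=> Jx; have rd := rho_der Jx.
apply: is_derive_eq; first by apply: is_deriveV; exact: rho0.
by rewrite expr2 invfM [LHS]mulNr.
Qed.

Lemma faval_diff_der a m i : U m ->
  differentiable (faval ^~ a) m /\
  partial i (faval ^~ a) m = ev m (frame_rules i a).
Proof.
move=> Um; case: a => [j|k||||] /=.
- have [|d ->] := @partial_coord _ id j i m; first exact: derivable_id.
  split => //.
  by rewrite derive1_id mulr1; case: ifP => /= [/eqP/val_inj -> |/negP ij];
     rewrite ?eqxx //; case: eqP => // ji; case: ij; rewrite ji.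
- have /derivableP Id := @I_smooth k _ Um.
  have [d ->] := base i Id; split => //; rewrite -derive1E.
  by move: i; apply: ord5_ind.
- have [d ->] := base i (rho_der Um); split => //.
  by move: i; apply: ord5_ind.
- have [d ->] := base i (rho1_der Um); split => //.
  by move: i; apply: ord5_ind => //=; field.
- have [d ->] := base i (inv_der Um); split => //.
  by move: i; apply: ord5_ind.
- have [d ->] := base i (th_der Um); split => //.
  by move: i; apply: ord5_ind.
Qed.

Lemma faval_diff e m : U m -> differentiable (fun m' => ev m' e) m.
Proof.
move=> Um; apply: (deval_differentiable (U := U)) => // a m' Um'.
by have [] := faval_diff_der a ix Um'.
Qed.

Lemma partial_faval e m i : U m ->
  partial i (fun m' => ev m' e) m = ev m (fder i e).
Proof.
move=> Um; apply: (partial_deval (U := U)) => // a m'.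
  by move=> Um'; have [] := faval_diff_der a ix Um'.
by move=> i' Um'; have [] := faval_diff_der a i' Um'.
Qed.

Variable g : 'rV[R]_5 -> 'M[R]_5.
Hypothesis g_frame : forall m i j, U m -> g m i j = ev m (gF i j).
Hypothesis christoffel_frame : forall m k i j, U m ->
  christoffel g k i j m = ev m (christoffelF k i j).

(** Each d phi_n is parallel up to a multiple of rho^-2 dx in the direction of x,
    since the Hessian of phi_n is - y rho theta^n dx^2; as the coefficients of g
    in the coframe are constant, the covariant derivative of zeta is then forced
    to be the combination of the d phi_n in the last row of [connectionF]. *)
Lemma coframe_eq m a i j : U m ->
  partial i (fun m' => ev m' (coframeF a j)) m
  - \sum_k ev m (coframeF a k) * christoffel g k i j m =
  (i == ix)%:R * \sum_b ev m (connectionF a b) * ev m (coframeF b j).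
Proof.
move=> Um; rewrite partial_faval //.
pose e1 := (fder i (coframeF a j) - dsum5 (fun k => coframeF a k * christoffelF k i j))%D.
pose e2 := (if (i : nat) is 0%N then dsum5 (fun b => connectionF a b * coframeF b j) else D0)%D.
have vO : faval m FO = (faval m Frho)^-1 by [].
have v0 : faval m Frho != 0 by exact: rho0.
transitivity (ev m e1).
  rewrite /e1 deval_add deval_opp deval_dsum5; congr (_ - _).
  by apply: eq_bigr => k _; rewrite deval_mul christoffel_frame.
transitivity (ev m e2); last first.
  rewrite {e1}/e2; move: i; apply: ord5_ind; rewrite ?[_ == _]/=;
    rewrite ?mul0r ?mul1r //.
  by rewrite deval_dsum5; apply: eq_bigr => b _; rewrite deval_mul.
rewrite {}/e1 {}/e2; move: (faval m) vO v0 => v vO v0 {Um}.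
move: a i j; do 3! apply: ord5_ind; dpoly_compute; rewrite ?vO; by field.
Qed.

Lemma coframe_metric m i j : U m ->
  g m i j = \sum_a \sum_b
    ev m (pairingF a b) * (ev m (coframeF a i) * ev m (coframeF b j)).
Proof.
move=> Um; rewrite g_frame //.
have v0 : faval m Frho != 0 by exact: rho0.
have vO : faval m FO = (faval m Frho)^-1 by [].
transitivity (ev m (dsum5 (fun a => dsum5 (fun b =>
  pairingF a b * (coframeF a i * coframeF b j))%D))); last first.
  rewrite deval_dsum5; apply: eq_bigr => a _.
  by rewrite deval_dsum5; apply: eq_bigr => b _; rewrite !deval_mul.
move: (faval m) vO v0 => v vO v0 {Um}.
move: i j; apply: ord5_ind; apply: ord5_ind; dpoly_compute; rewrite ?vO; by field.
Qed.

End Frame.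

(** * Antiderivatives on an open interval *)

Section Antiderivative.
Variables (R : realType) (J : set R) (f : R -> R).
Hypotheses (oJ : open J) (iJ : is_interval J).
Hypothesis cf : forall x, J x -> {for x, continuous f}.
Local Notation mu := (@lebesgue_measure R).

Lemma open_room x : J x -> exists2 e : R, 0 < e & J (x - e) /\ J (x + e).
Proof.
move=> Jx; have /nbhs_normP[d /= d0 H] : nbhs x J by exact: open_nbhs_nbhs.
exists (d / 2); first by rewrite divr_gt0.
have hd : `|d / 2| < d by rewrite gtr0_norm; lra.
split; apply: H; rewrite /ball_ /=.
  by rewrite (_ : x - (x - d / 2) = d / 2) //; ring.
by rewrite (_ : x - (x + d / 2) = - (d / 2)) ?normrN //; ring.
Qed.

(** The integral from a base point x0, with a sign on its left.  Near a given x
    it differs by a constant from the integral from a point a to the left of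
    both x and x0, to which the fundamental theorem applies. *)
Lemma antiderivative : exists F : R -> R, forall x, J x -> is_derive x 1 F (f x).
Proof.
have [/eqP J0|/set0P[x0 Jx0]] := boolP (J == set0).
  by exists (fun=> 0) => x; rewrite J0.
pose F x := if x0 <= x then \int[mu]_(t in `[x0, x]) f t
            else - \int[mu]_(t in `[x, x0]) f t.
have fi a b : J a -> J b -> mu.-integrable `[a, b] (EFin \o f).
  move=> Ja Jb; apply: continuous_compact_integrable; first exact: segment_compact.
  apply: continuous_in_subspaceT => t; rewrite inE /= in_itv /= => /(iJ Ja Jb).
  exact: cf.
exists F => x Jx.
have [a [Ja ax ax0]] : exists a, [/\ J a, a < x & a < x0].
  case: (leP x x0) => xx0.
    have [e e0 [Je _]] := open_room Jx; exists (x - e); split => //; lra.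
  have [e e0 [Je _]] := open_room Jx0; exists (x0 - e); split => //; lra.
have [u [Ju xu x0u]] : exists u, [/\ J u, x < u & x0 < u].
  case: (leP x x0) => xx0.
    have [e e0 [_ Je]] := open_room Jx0; exists (x0 + e); split => //; lra.
  have [e e0 [_ Je]] := open_room Jx; exists (x + e); split => //; lra.
pose G y := \int[mu]_(t in `[a, y]) f t.
have [dG GE] : derivable G x 1 /\ G^`()%classic x = f x.
  by apply: (continuous_FTC1_closed xu) => //; [exact: fi|exact: cf].
have split_int b y : J y -> a <= b -> b <= y ->
    G y - G b = \int[mu]_(t in `[b, y]) f t.
  move=> Jy ab bz; rewrite /G Rintegral_itvB //; [|exact: fi|by rewrite bnd_simp..].
  apply: Rintegral_itv_obnd_cbnd; apply: (integrableS _ _ _ (fi a y Ja Jy)) => //.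
  by apply: subset_itvr; rewrite bnd_simp.
have FG : \forall y \near x, G y - G x0 = F y.
  near=> y.
  have ay : a < y by near: y; exact: lt_nbhsr.
  have yu : y < u by near: y; exact: lt_nbhsl.
  have Jy : J y by apply: (iJ Ja Ju); rewrite !ltW.
  rewrite /F; case: ifPn => [x0y|]; first by rewrite split_int // ltW.
  rewrite -ltNge => yx0; rewrite -split_int ?ltW //; ring.
apply: (near_eq_is_derive FG).
rewrite -[f x]subr0; apply: is_deriveB.
by apply: (DeriveDef dG); rewrite -derive1E.
Unshelve. all: by end_near. Qed.

End Antiderivative.

(** * Real curves and a nilpotent algebra *)

Section RealCurves.
Variable R : realType.
Implicit Types f g : R -> R.

Lemma is_derive_mul f g (t df dg : R) : is_derive t 1 f df -> is_derive t 1 g dg ->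
  is_derive t 1 (fun s => f s * g s) (df * g t + f t * dg).
Proof.
move=> f1 g1; have := @is_deriveM _ _ f g t 1 df dg f1 g1.
by rewrite addrC [df * _]mulrC.
Qed.

Lemma is_derive_bigsum n (f : 'I_n -> R -> R) (df : 'I_n -> R) (t : R) :
  (forall i, is_derive t 1 (f i) (df i)) ->
  is_derive t 1 (fun s => \sum_i f i s) (\sum_i df i).
Proof.
move=> fd; rewrite (_ : (fun s => _) = \sum_i f i); first exact: is_derive_sum.
by apply/funext => s; rewrite fct_sumE.
Qed.

Lemma continuous_mul (T : topologicalType) (f g : T -> R) :
  continuous f -> continuous g -> continuous (fun s => f s * g s).
Proof. by move=> cf cg x; apply: cvgM; [exact: cf|exact: cg]. Qed.

Lemma continuous_bigsum (T : topologicalType) n (f : 'I_n -> T -> R) :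
  (forall i, continuous (f i)) -> continuous (fun s => \sum_i f i s).
Proof.
elim: n f => [|n IH] f cf.
  rewrite (_ : (fun s => _) = fun=> 0); first by move=> x; exact: cvg_cst.
  by apply/funext => s; rewrite big_ord0.
rewrite (_ : (fun s => _) =
    (fun s => \sum_(i < n) f (widen_ord (leqnSn n) i) s + f ord_max s)).
  move=> x; apply: cvgD; last exact: cf.
  by apply: (IH (fun i => f (widen_ord (leqnSn n) i))) => i; exact: cf.
by apply/funext => s; rewrite big_ord_recr.
Qed.

Lemma path_const (T : Type) (F : R -> T) x (s : seq R) :
  (forall k, (k < size s)%N -> F (nth 0 (x :: s) k.+1) = F (nth 0 (x :: s) k)) ->
  F (last x s) = F x.
Proof.
elim: s x => //= y s IH x H; rewrite IH; first exact: (H 0%N).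
by move=> k ks; exact: (H k.+1).
Qed.

Lemma path_nth_bounds (s : seq R) k : path <%R 0 s -> last 0 s = 1 -> (k < size s)%N ->
  [/\ 0 <= nth 0 (0 :: s) k, nth 0 (0 :: s) k < nth 0 (0 :: s) k.+1
    & nth 0 (0 :: s) k.+1 <= 1].
Proof.
move=> ps ls ks; have sp : sorted <%R (0 :: s) by [].
have szs : (0 < size s)%N by exact: leq_ltn_trans ks.
have mono i j : (i <= j)%N -> (j <= size s)%N ->
    nth 0 (0 :: s) i <= nth 0 (0 :: s) j.
  move=> ij js; apply: (sorted_leq_nth (@le_trans _ _) (@lexx _ _)) => //.
  - by move: sp; apply: sub_sorted => a b /ltW.
  - by rewrite inE /= ltnS (leq_trans ij).
split.
- by apply: (mono 0%N k) => //; exact: ltnW.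
- by apply: (sorted_ltn_nth lt_trans) => //; rewrite inE /= ltnS // ltnW.
- by rewrite -[leRHS]ls (last_nth 0); apply: mono.
Qed.

End RealCurves.

Section Nilpotent.
Variable R : realFieldType.
Definition k0 : 'I_3 := @Ordinal 3 0 isT.
Definition k1 : 'I_3 := @Ordinal 3 1 isT.
Definition k2 : 'I_3 := @Ordinal 3 2 isT.

(** The matrix of the connection in the coframe.  The product of any three such
    matrices is 0, and two of them commute. *)
Definition nilmx (w : 'rV[R]_3) : 'M[R]_5 := \matrix_(a, b)
  match (a : nat), (b : nat) with
  | 1%N, 0%N => w 0 k0
  | 2%N, 0%N => w 0 k1
  | 3%N, 0%N => w 0 k2
  | 4%N, 1%N => - (w 0 k2 / 4)
  | 4%N, 2%N => w 0 k1 / 2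
  | 4%N, 3%N => - (w 0 k0 / 4)
  | _, _ => 0
  end.

(** The exponential 1 + N + N^2 / 2 of N = [nilmx w]. *)
Definition expmx (w : 'rV[R]_3) : 'M[R]_5 := \matrix_(a, b)
  match (a : nat), (b : nat) with
  | 1%N, 0%N => w 0 k0
  | 2%N, 0%N => w 0 k1
  | 3%N, 0%N => w 0 k2
  | 4%N, 0%N => (w 0 k1 ^+ 2 - w 0 k0 * w 0 k2) / 4
  | 4%N, 1%N => - (w 0 k2 / 4)
  | 4%N, 2%N => w 0 k1 / 2
  | 4%N, 3%N => - (w 0 k0 / 4)
  | 0%N, 0%N | 1%N, 1%N | 2%N, 2%N | 3%N, 3%N | 4%N, 4%N => 1
  | _, _ => 0
  end.

Lemma expmxD u v : expmx (u + v) = expmx u *m expmx v.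
Proof.
apply/matrixP; do 2! apply: ord5_ind; rewrite [RHS]mxE sum5 !mxE /=; by field.
Qed.

Lemma expmx0 : expmx 0 = 1%:M.
Proof.
by apply/matrixP; do 2! apply: ord5_ind; rewrite !mxE /=; field.
Qed.

End Nilpotent.

(** * Conserved quantities of parallel transport *)

Section ParallelTransport.
Variables (R : realType) (U : set 'rV[R]_5) (g B : 'rV[R]_5 -> 'M[R]_5)
  (rate : 'rV[R]_5 -> 'rV[R]_3).
Hypothesis B_diff : forall m a j, U m -> differentiable (fun m' => B m' a j) m.
Hypothesis B_partial : forall m a i j, U m ->
  partial i (fun m' => B m' a j) m =
  \sum_k B m a k * christoffel g k i j m +
  (i == ix)%:R * \sum_b nilmx (rate m) a b * B m b j.
Implicit Types (c V : R -> 'rV[R]_5).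
Local Notation comp c V t a := ((B (c t) *m (V t)^T) a 0).

Lemma is_derive_coord c (t : R) dc i : is_derive t 1 c dc ->
  is_derive t 1 (fun s => c s 0 i) (dc 0 i).
Proof.
move=> [cd <-]; apply: DeriveDef; first by have /derivable_mxP := cd.
by rewrite (derive_mx cd) mxE.
Qed.

(** For a parallel V the first sum vanishes, and the components of V in the
    coframe satisfy the linear equation xi' = x' N(rate) xi. *)
Lemma is_derive_comp c V (t : R) (dc dV : 'rV[R]_5) a :
  is_derive t 1 c dc -> U (c t) -> is_derive t 1 V dV ->
  is_derive t 1 (fun s => comp c V s a)
   (\sum_j B (c t) a j * (dV 0 j + \sum_i \sum_k
      christoffel g j i k (c t) * dc 0 i * V t 0 k)
    + dc 0 ix * \sum_b nilmx (rate (c t)) a b * comp c V t b).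
Proof.
move=> cd Uc Vd.
rewrite (_ : (fun s => _) = fun s => \sum_j B (c s) a j * V s 0 j); last first.
  by apply/funext => s; rewrite mxE; apply: eq_bigr => j _; rewrite mxE.
have -> : dc 0 ix * (\sum_b nilmx (rate (c t)) a b * comp c V t b) =
    \sum_j \sum_i dc 0 i * ((i == ix)%:R *
      \sum_b nilmx (rate (c t)) a b * B (c t) b j) * V t 0 j.
  have pick (X Y : R) : \sum_i dc 0 i * ((i == ix)%:R * X) * Y = dc 0 ix * (X * Y).
    by rewrite sum5 /= !(mul0r, mulr0, mul1r, addr0) mulrA.
  under [RHS]eq_bigr do rewrite pick mulr_suml.
  rewrite -mulr_sumr exchange_big /=; congr (_ * _); apply: eq_bigr => b _.
  rewrite [X in _ * X = _]mxE mulr_sumr; apply: eq_bigr => j _.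
  by rewrite [X in _ * (_ * X) = _]mxE mulrA.
have -> : \sum_j B (c t) a j * (dV 0 j + \sum_i \sum_k
      christoffel g j i k (c t) * dc 0 i * V t 0 k) =
   \sum_j (B (c t) a j * dV 0 j + \sum_i dc 0 i *
     (\sum_k B (c t) a k * christoffel g k i j (c t)) * V t 0 j).
  under eq_bigr do rewrite mulrDr; rewrite !big_split /=; congr (_ + _).
  under eq_bigr do rewrite mulr_sumr; rewrite exchange_big /=.
  rewrite [RHS]exchange_big /=; apply: eq_bigr => i _.
  under eq_bigr do rewrite mulr_sumr; rewrite exchange_big /=.
  apply: eq_bigr => k _; rewrite mulr_sumr mulr_suml; apply: eq_bigr => j _.
  ring.
rewrite -big_split /=; apply: is_derive_bigsum => j.
have D := is_derive_mul (is_derive_curve cd (B_diff a j Uc)) (is_derive_coord j Vd).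
apply: (is_derive_eq D).
rewrite -[RHS]addrA [LHS]addrC; congr (_ + _).
rewrite -big_split /= mulr_suml; apply: eq_bigr => i _.
by rewrite B_partial // mulrDr mulrDl.
Qed.

(** Linear and bilinear functions of the components in the coframe that are
    annihilated by all the matrices [nilmx w] are first integrals.  They
    determine the transport along any piecewise smooth curve, without solving
    the differential equation. *)
Lemma transport_conserved (s : seq R) c V1 V2 (L : 'I_5 -> R) (Q : 'I_5 -> 'I_5 -> R) :
  (forall w (x : 'I_5 -> R), \sum_a L a * \sum_b nilmx w a b * x b = 0) ->
  (forall w (x y : 'I_5 -> R), \sum_a \sum_b Q a b *
     ((\sum_k nilmx w a k * x k) * y b + x a * \sum_k nilmx w b k * y k) = 0) ->
  piecewise_smooth U s c -> parallel_along g s c V1 -> parallel_along g s c V2 ->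
  let F t := \sum_a L a * comp c V1 t a
     + \sum_a \sum_b Q a b * (comp c V1 t a * comp c V2 t b) in
  F 1 = F 0.
Proof.
move=> HL HQ [ps ls Uc dk] [cV1 pV1] [cV2 pV2] F.
rewrite -[in LHS]ls; apply: path_const => k ks.
have [a0 ab b1] := path_nth_bounds ps ls ks.
have [d d_smooth cd] := dk k ks.
have {}pV1 := pV1 k ks; have {}pV2 := pV2 k ks.
move: (nth 0 (0 :: s) k) (nth 0 (0 :: s) k.+1) a0 ab b1 cd pV1 pV2 => a b a0 ab b1.
move=> cd pV1 pV2.
(* On each piece, the curve is replaced by a smooth extension of it. *)
pose G t := \sum_a L a * comp d V1 t a
     + \sum_a \sum_b Q a b * (comp d V1 t a * comp d V2 t b).
have FG t : a <= t <= b -> F t = G t by move=> tab; rewrite /F /G cd.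
have Ud t : a <= t <= b -> U (d t).
  move=> tab; rewrite -cd //; apply: Uc; case/andP: tab => *.
  by apply/andP; split; lra.
have dder (t : R) : is_derive t 1 d (derive1 d t).
  have := @d_smooth 0%N t I; rewrite derive1n0 => dt.
  by apply: (DeriveDef dt); rewrite derive1E.
have compder V (t : R) i : a < t < b -> is_derive t 1 V (- \row_a \sum_i \sum_j
             christoffel g a i j (c t) * (derive1 c t) 0 i * (V t) 0 j) ->
    is_derive t 1 (fun s => comp d V s i)
     (derive1 d t 0 ix * \sum_b nilmx (rate (d t)) i b * comp d V t b).
  move=> /andP[at_ tb] dV.
  have tab : a <= t <= b by rewrite !ltW.
  have cdt : \near t, c t = d t.
    near=> u; apply: cd; apply/andP; split; apply: ltW; near: u.
      exact: lt_nbhsr.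
    exact: lt_nbhsl.
  have c1 : derive1 c t = derive1 d t by rewrite !derive1E; exact: near_eq_derive.
  have D := is_derive_comp i (dder t) (Ud t tab) dV.
  apply: (is_derive_eq D); rewrite -[RHS]add0r; congr (_ + _).
  apply: big1 => j _; rewrite !mxE c1 cd //.
  by rewrite addNr mulr0.
have withinV V i : {within `[0, 1], continuous V} ->
    {within `[a, b], continuous (fun t => comp d V t i)}.
  move=> cV; rewrite (_ : (fun t => _) = fun t => \sum_j B (d t) i j * V t 0 j).
    apply: continuous_bigsum => j; apply: continuous_mul.
      apply: continuous_in_subspaceT => t; rewrite inE /= in_itv /= => tab.
      apply: (@continuous_comp _ _ _ d (fun m => B m i j)).
        by apply: differentiable_continuous; apply/derivable1_diffP; have [] := dder t.
      by apply: differentiable_continuous; apply: B_diff; exact: Ud.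
    have cV' : {within `[a, b], continuous V}.
      apply: continuous_subspaceW cV => t /=; rewrite !in_itv /= => /andP[? ?].
      by apply/andP; split; lra.
    move=> t; apply: (@continuous_comp (subspace `[a, b]) _ _ V
      (fun v : 'rV[R]_5 => v 0 j)); first exact: cV'.
    exact: coord_continuous.
  by apply/funext => t; rewrite mxE; apply: eq_bigr => j _; rewrite mxE.
rewrite !FG ?lexx ?(ltW ab) //.
have Gder (t : R) : t \in `]a, b[ -> is_derive t 1 G 0.
  rewrite in_itv /= => tab.
  have D1 := is_derive_bigsum (fun i => is_derive_mul (is_derive_cst (L i) t 1)
    (compder V1 t i tab (pV1 t tab))).
  have D2 := is_derive_bigsum (fun i => is_derive_bigsum (fun j =>
    is_derive_mul (is_derive_cst (Q i j) t 1)
    (is_derive_mul (compder V1 t i tab (pV1 t tab)) (compder V2 t j tab (pV2 t tab))))).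
  apply: (is_derive_eq (is_deriveD D1 D2)).
  set X := fun i => comp d V1 t i; set Y := fun i => comp d V2 t i.
  transitivity (derive1 d t 0 ix * (\sum_a0 L a0 * \sum_b nilmx (rate (d t)) a0 b * X b)
    + derive1 d t 0 ix * (\sum_a0 \sum_b Q a0 b *
     ((\sum_k nilmx (rate (d t)) a0 k * X k) * Y b
       + X a0 * \sum_k nilmx (rate (d t)) b k * Y k))); last first.
    by rewrite HL HQ !mulr0 addr0.
  rewrite [X in X + _ = _]/= [X in _ = X + _]mulr_sumr [X in _ = _ + X]mulr_sumr.
  congr (_ + _); apply: eq_bigr => i _ /=.
    by rewrite mul0r add0r mulrCA.
  rewrite [RHS]mulr_sumr; apply: eq_bigr => j _ /=.
  by rewrite mul0r add0r [RHS]mulrCA; congr (_ * _); rewrite /X /Y; ring.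
have Gc : {within `[a, b], continuous G}.
  apply: within_continuousD.
    apply: continuous_bigsum => i; apply: continuous_mul; last exact: withinV.
    by move=> ?; exact: cvg_cst.
  apply: continuous_bigsum => i; apply: continuous_bigsum => j; apply: continuous_mul.
    by move=> ?; exact: cvg_cst.
  by apply: continuous_mul; exact: withinV.
have [u _] := MVT_segment (ltW ab) Gder Gc.
by rewrite mul0r => /eqP; rewrite subr_eq0 => /eqP.
Unshelve. all: by end_near. Qed.

End ParallelTransport.

(** * The holonomy group in the coframe *)

Section HolonomyGroup.
Variables (R : realType) (U : set 'rV[R]_5) (g B Binv : 'rV[R]_5 -> 'M[R]_5)
  (rate : 'rV[R]_5 -> 'rV[R]_3).
Hypothesis B_diff : forall m a j, U m -> differentiable (fun m' => B m' a j) m.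
Hypothesis Binv_diff : forall m a j, U m -> differentiable (fun m' => Binv m' a j) m.
Hypothesis BinvB : forall m, U m -> Binv m *m B m = 1%:M.
Hypothesis B_partial : forall m a i j, U m ->
  partial i (fun m' => B m' a j) m =
  \sum_k B m a k * christoffel g k i j m +
  (i == ix)%:R * \sum_b nilmx (rate m) a b * B m b j.
Local Notation comp c V t a := ((B (c t) *m (V t)^T) a 0).

Lemma sum_skew (n : 'I_5) (Z : 'I_5 -> 'I_5 -> R) : (0 < n < 4)%N -> \sum_a \sum_b
  ((a == n)%:R * (b == ix)%:R - (a == ix)%:R * (b == n)%:R) * Z a b
  = Z n ix - Z ix n.
Proof. by move: n; apply: ord5_ind => // _; rewrite !sum5 /=; ring. Qed.

Definition hol_elt m w : 'M[R]_5 := Binv m *m expmx w *m B m.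

Lemma BBinv m : U m -> B m *m Binv m = 1%:M.
Proof. by move=> Um; apply: mulmx1C; exact: BinvB. Qed.

Definition pairing (a b : 'I_5) : R :=
  match (a : nat), (b : nat) with
  | 0%N, 4%N | 4%N, 0%N => 1
  | 1%N, 3%N | 3%N, 1%N => 4^-1
  | 2%N, 2%N => - 2^-1
  | _, _ => 0
  end.

(** X and Y are the initial and final components of a parallel field, and Z the
    final components of the parallel field that starts at the first vector of
    the frame.  The form [pairing] is the metric; the other first integrals are
    the first component and the skew forms Y_n Z_0 - Y_0 Z_n for n = 1, 2, 3,
    because N(w) maps xi to w_n xi_0 in these components. *)
Lemma expmx_of_invariants (w : 'rV[R]_3) (X Y Z : 'I_5 -> R) :
  Z ix = 1 -> Z iy = w 0 k0 -> Z ip = w 0 k1 -> Z iq = w 0 k2 -> Y ix = X ix ->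
  (forall n : 'I_5, (0 < n < 4)%N -> Y n * Z ix - Y ix * Z n = X n) ->
  \sum_a \sum_b pairing a b * (Y a * Z b) = X iz ->
  \sum_a \sum_b pairing a b * (Z a * Z b) = 0 ->
  forall a, Y a = \sum_b expmx w a b * X b.
Proof.
move=> Z0 Z1 Z2 Z3 Y0 skew; rewrite !sum5 /pairing /=.
have := skew iy isT; have := skew ip isT; have := skew iq isT.
rewrite Z0 Z1 Z2 Z3 Y0 !mulr1 => e3 e2 e1 eY eZ.
have {}e1 : Y iy = X iy + X ix * w 0 k0 by rewrite -e1; ring.
have {}e2 : Y ip = X ip + X ix * w 0 k1 by rewrite -e2; ring.
have {}e3 : Y iq = X iq + X ix * w 0 k2 by rewrite -e3; ring.
have {}eZ : Z iz = (w 0 k1 ^+ 2 - w 0 k0 * w 0 k2) / 4 by lra.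
rewrite eZ e1 e2 e3 in eY.
have {}eY : Y iz = X iz + X ix * ((w 0 k1 ^+ 2 - w 0 k0 * w 0 k2) / 4)
    - X iy * w 0 k2 / 4 + X ip * w 0 k1 / 2 - X iq * w 0 k0 / 4.
  by rewrite -eY; field.
apply: ord5_ind; rewrite sum5 !mxE /= ?(Y0, e1, e2, e3, eY); by field.
Qed.

(** The parameter w consists of the components 1, 2, 3 of the transport of the
    first vector of the frame. *)
Lemma holonomy_sub m P : U m -> holonomy U g m P -> exists w, P = hol_elt m w.
Proof.
move=> Um [s [c [pc c0 c1 HV]]].
have [Vp [pVp Vp0 Vp1]] := HV (Binv m *m delta_mx ix 0)^T.
rewrite trmxK in Vp1.
have xp a : comp c Vp 0 a = (a == ix)%:R.
  by rewrite Vp0 c0 trmxK mulmxA BBinv // mul1mx mxE eqxx andbT.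
pose w : 'rV[R]_3 := \row_k comp c Vp 1 (if (k : nat) == 0%N then iy
   else if (k : nat) == 1%N then ip else iq).
have w0 : comp c Vp 1 iy = w 0 k0 by rewrite [RHS]mxE.
have w1 : comp c Vp 1 ip = w 0 k1 by rewrite [RHS]mxE.
have w2 : comp c Vp 1 iq = w 0 k2 by rewrite [RHS]mxE.
have L_inv (u : 'rV[R]_3) (x : 'I_5 -> R) :
    \sum_a (a == ix)%:R * \sum_b nilmx u a b * x b = 0.
  by rewrite !sum5 !mxE /=; ring.
have Q_inv (n : 'I_5) : (0 < n < 4)%N -> forall (u : 'rV[R]_3) (x y : 'I_5 -> R), \sum_a \sum_b
    ((a == n)%:R * (b == ix)%:R - (a == ix)%:R * (b == n)%:R) *
     ((\sum_k nilmx u a k * x k) * y b + x a * \sum_k nilmx u b k * y k) = 0.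
  move=> n14 u x y; rewrite (sum_skew (fun a b => (\sum_k nilmx u a k * x k) * y b
    + x a * \sum_k nilmx u b k * y k)) //.
  by move: n n14; apply: ord5_ind => // _; rewrite !sum5 !mxE /=; ring.
have K_inv (u : 'rV[R]_3) (x y : 'I_5 -> R) : \sum_a \sum_b pairing a b *
     ((\sum_k nilmx u a k * x k) * y b + x a * \sum_k nilmx u b k * y k) = 0.
  by rewrite !sum5 /pairing !mxE /=; field.
exists w.
suff E (v : 'cV[R]_5) : P *m v = hol_elt m w *m v.
  by apply/matrixP => i j; have /colP/(_ i) := E (delta_mx j 0);
    rewrite -!colE !mxE.
have [V [pV V0 V1]] := HV v^T; rewrite trmxK in V1.
have Uc1 : U (c 1) by rewrite c1.
suff N : B m *m (P *m v) = expmx w *m (B m *m v).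
  by rewrite /hol_elt -!mulmxA -N !mulmxA BinvB // mul1mx.
have y_eq a : (B m *m (P *m v)) a 0 = comp c V 1 a by rewrite -V1 c1.
have x_eq a : (B m *m v) a 0 = comp c V 0 a by rewrite V0 c0 trmxK.
have Q0 (u : 'rV[R]_3) (x y : 'I_5 -> R) : \sum_a \sum_b (0 : R) *
    ((\sum_k nilmx u a k * x k) * y b + x a * \sum_k nilmx u b k * y k) = 0.
  by apply: big1 => a _; apply: big1 => b _; rewrite mul0r.
have L0 (u : 'rV[R]_3) (x : 'I_5 -> R) :
    \sum_a (0 : R) * \sum_b nilmx u a b * x b = 0.
  by apply: big1 => a _; rewrite mul0r.
have head V' : parallel_along g s c V' -> comp c V' 1 ix = comp c V' 0 ix.
  move=> pV'; have := transport_conserved B_diff B_partial L_inv Q0 pc pV' pV'.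
  rewrite /= !sum5; set X := fun t a => comp c V' t a.
  rewrite -!/(X _ _); move: X => X /=.
  by rewrite !(mul0r, mul1r, addr0, add0r).
have skew (n : 'I_5) : (0 < n < 4)%N ->
    comp c V 1 n * comp c Vp 1 ix - comp c V 1 ix * comp c Vp 1 n
    = comp c V 0 n * comp c Vp 0 ix - comp c V 0 ix * comp c Vp 0 n.
  move=> n14; have := transport_conserved B_diff B_partial L0 (Q_inv n n14) pc pV pVp.
  rewrite /= !(sum_skew (fun a b => comp c V _ a * comp c Vp _ b)) //.
  by rewrite ![\sum_a 0 * _]big1 ?add0r // => a _; rewrite mul0r.
have pair V' : parallel_along g s c V' ->
    \sum_a \sum_b pairing a b * (comp c V' 1 a * comp c Vp 1 b)
    = \sum_a \sum_b pairing a b * (comp c V' 0 a * comp c Vp 0 b).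
  move=> pV'; have := transport_conserved B_diff B_partial L0 K_inv pc pV' pVp.
  have zero (X : 'I_5 -> R) : \sum_a 0 * X a = 0.
    by apply: big1 => a _; rewrite mul0r.
  by rewrite /= !(zero (fun a => comp c V' _ a)) !add0r.
apply/colP => a; rewrite [RHS]mxE y_eq.
under [RHS]eq_bigr do rewrite x_eq.
have at0 (X : 'I_5 -> R) :
    \sum_a0 \sum_b pairing a0 b * (X a0 * comp c Vp 0 b) = X iz.
  under eq_bigr do under eq_bigr do rewrite xp.
  by rewrite !sum5 /pairing /=; ring.
have hp : comp c Vp 1 ix = 1 by rewrite head // xp.
apply: (expmx_of_invariants (X := fun a => comp c V 0 a) (Y := fun a => comp c V 1 a)
  (Z := fun a => comp c Vp 1 a)) => //.
- exact: head.
- move=> n n14; rewrite skew // !xp eqxx mulr1.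
  by case: eqP n14 => [->|]//; rewrite mulr0 subr0.
- by rewrite pair // (at0 (fun a => comp c V 0 a)).
- by rewrite pair // (at0 (fun a => comp c Vp 0 a)) xp.
Qed.

Lemma is_derive_expmx (W : R -> 'rV[R]_3) (t : R) (dW : 'rV[R]_3) a b :
  (forall k, is_derive t 1 (fun s => W s 0 k) (dW 0 k)) ->
  is_derive t 1 (fun s => expmx (W s) a b) ((nilmx dW *m expmx (W t)) a b).
Proof.
move=> Wd; have d0 := Wd k0; have d1 := Wd k1; have d2 := Wd k2.
have c0 (r : R) : is_derive t 1 (fun=> r) 0 by exact: is_derive_cst.
rewrite mxE sum5.
move: a b; apply: ord5_ind; apply: ord5_ind; rewrite !mxE /=;
  under eq_fun do rewrite mxE /=.
all: (apply: is_derive_eq; rewrite /GRing.scale /=; by field).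
Qed.
(** As the matrices N(w) commute, exp(N(W)) with W' = x' rate solves the
    equation of parallel transport in the coframe. *)
Lemma holonomy_sup m (d : R -> 'rV[R]_5) (W : R -> 'rV[R]_3) : U m ->
  smooth1_on setT d -> (forall t, 0 <= t <= 1 -> U (d t)) -> d 0 = m -> d 1 = m ->
  (forall (t : R) k, 0 <= t <= 1 -> is_derive t 1 (fun s => W s 0 k)
     (derive1 d t 0 ix * rate (d t) 0 k)) -> W 0 = 0 ->
  holonomy U g m (hol_elt m (W 1)).
Proof.
move=> Um d_smooth Ud d0 d1 Wd W0; exists [:: 1], d; split => //.
  split => //=; first by rewrite ltr01.
  by case=> // _; exists d.
move=> v; pose y t := expmx (W t) *m (B m *m v^T).
pose V t := (Binv (d t) *m y t)^T; exists V; split; last 2 first.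
- by rewrite /V /y d0 W0 expmx0 mul1mx mulmxA BinvB // mul1mx trmxK.
- by rewrite /V /y d1 trmxK !mulmxA.
have dder (t : R) : is_derive t 1 d (derive1 d t).
  have := @d_smooth 0%N t I; rewrite derive1n0 => dt.
  by apply: (DeriveDef dt); rewrite derive1E.
have yder (t : R) a : 0 <= t <= 1 -> is_derive t 1 (fun s => y s a 0)
    ((derive1 d t 0 ix) * (nilmx (rate (d t)) *m y t) a 0).
  move=> t01; pose dW := derive1 d t 0 ix *: rate (d t).
  have Wd' k : is_derive t 1 (fun s => W s 0 k) (dW 0 k) by rewrite mxE; exact: Wd.
  have D := is_derive_bigsum (fun b => is_derive_mul (is_derive_expmx a b Wd')
    (is_derive_cst ((B m *m v^T) b 0) t 1)).
  rewrite (_ : (fun s => y s a 0) =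
    fun s => \sum_b expmx (W s) a b * (B m *m v^T) b 0); last first.
    by apply/funext => s; rewrite /y mxE.
  apply: (is_derive_eq D).
  under eq_bigr do rewrite mulr0 addr0.
  have -> : nilmx dW = derive1 d t 0 ix *: nilmx (rate (d t)).
    apply/matrixP; do 2! apply: ord5_ind; rewrite !mxE /=; ring.
  by rewrite /y mulmxA -scalemxAl [in RHS]mxE mulr_sumr; apply: eq_bigr => b _; rewrite mxE mulrA.
have Vder (t : R) : 0 <= t <= 1 -> is_derive t 1 V (derive1 V t).
  move=> t01; suff dV : derivable V t 1 by exact: (DeriveDef dV (esym (derive1E V t))).
  apply/derivable_mxP => i j; rewrite ord1.
  rewrite (_ : (fun s => _) = fun s => \sum_a Binv (d s) j a * y s a 0); last first.
    by apply/funext => s; rewrite /V mxE mxE.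
  have D := is_derive_bigsum (fun a => is_derive_mul
    (is_derive_curve (dder t) (Binv_diff j a (Ud t t01))) (yder t a t01)).
  by case: D.
split.
  apply: derivable_within_continuous => t; rewrite in_itv /= => t01.
  by have [] := Vder t t01.
case=> // _ t /= /andP[t0 t1].
have t01 : 0 <= t <= 1 by rewrite !ltW.
have Vt := Vder t t01.
suff E : derive1 V t = - \row_a \sum_i \sum_j
    christoffel g a i j (d t) * derive1 d t 0 i * V t 0 j by rewrite -E.
pose z : 'cV[R]_5 := \col_j (derive1 V t 0 j
   + \sum_i \sum_k christoffel g j i k (d t) * derive1 d t 0 i * V t 0 k).
suff z0 : z = 0.
  apply/rowP => a; rewrite !mxE; apply/eqP; rewrite -addr_eq0; apply/eqP.
  by have /colP/(_ a) := z0; rewrite !mxE.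
have Utd := Ud t t01.
(* The covariant derivative z of V vanishes once its components in the coframe
   do; these compare the derivative of B V given by [is_derive_comp] with that of
   y = B V. *)
suff Bz : B (d t) *m z = 0 by rewrite -[z]mul1mx -(BinvB Utd) -mulmxA Bz mulmx0.
apply/colP => a; rewrite mxE [RHS]mxE.
have BV s : U (d s) -> B (d s) *m (V s)^T = y s.
  by move=> Us; rewrite /V trmxK mulmxA BBinv // mul1mx.
have D1 := is_derive_comp B_diff B_partial a (dder t) Utd Vt.
have nearU : \near t, (B (d t) *m (V t)^T) a 0 = y t a 0.
  near=> s; rewrite BV //; apply: Ud; apply/andP; split; apply: ltW; near: s.
    exact: lt_nbhsr.
  exact: lt_nbhsl.
have [_ E1] := near_eq_is_derive nearU D1; have [_ E2] := yder t a t01.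
have {E2} E1 := etrans (esym E1) E2; rewrite (BV t Utd) in E1.
apply: (addIr (derive1 d t 0 ix * \sum_b nilmx (rate (d t)) a b * y t b 0)).
rewrite add0r [X in _ = _ * X](_ : _ = (nilmx (rate (d t)) *m y t) a 0);
  last by rewrite [RHS]mxE.
rewrite -E1; congr (_ + _); apply: eq_bigr => j _.
by rewrite [z _ _]mxE.
Unshelve. all: by end_near. Qed.

End HolonomyGroup.

(** * Continuity and smoothness *)

Lemma mx_continuous (R : realType) (T : topologicalType) m n
    (f : T -> 'M[R]_(m, n)) :
  (forall i j, continuous (fun x => f x i j)) -> continuous f.
Proof.
move=> cf x; apply/cvgrPdist_le => /= e e0; near=> y.
rewrite [leLHS]/Num.Def.normr/= mx_normrE (bigmax_le _ (ltW e0))//= => i _.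
rewrite !mxE; move: i; near: y; apply: filter_forall => /= i.
exact: ((cvgrPdist_le _ _).1 (cf i.1 i.2 x)).
Unshelve. all: by end_near. Qed.

Section Iso.
Variables (R : realType) (U : set 'rV[R]_5) (g B Binv : 'rV[R]_5 -> 'M[R]_5).
Hypothesis BinvB : forall m, U m -> Binv m *m B m = 1%:M.

(** Induction over the polynomial expressions of the entries. *)
Lemma expmx_polynomial (P : ('rV[R]_3 -> R) -> Prop) a b :
  (forall r, P (fun=> r)) -> (forall k, P (fun w => w 0 k)) ->
  (forall u v, P u -> P v -> P (fun w => u w * v w)) ->
  (forall u v, P u -> P v -> P (fun w => u w - v w)) ->
  P (fun w => expmx w a b).
Proof.
move=> Pc Pw Pm Ps.
have Po u : P u -> P (fun w => - u w).
  by move=> Pu; under eq_fun do rewrite -sub0r; exact: Ps.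
move: a b; apply: ord5_ind; apply: ord5_ind; under eq_fun do rewrite mxE /= ?expr2;
  do ?[exact: Pc|exact: Pw|apply: (Po _)|apply: (Pm _ _)|apply: (Ps _ _)].
Qed.

Lemma expmx_continuous : continuous (fun w : 'rV[R]_3 => expmx w).
Proof.
apply: mx_continuous => a b.
apply: (@expmx_polynomial (fun f => continuous f) a b).
- by move=> r; exact: cst_continuous.
- by move=> k; exact: coord_continuous.
- by move=> u v; exact: continuous_mul.
- by move=> u v cu cv w; exact: (cvgB (cu w) (cv w)).
Qed.

(** The parameter w is read off the first column of B P B^-1, which makes the
    inverse continuous. *)
Lemma holonomy_iso m : U m ->
  (forall P, holonomy U g m P <-> exists w, P = hol_elt B Binv m w) ->
  isomorphic_to_Rn 3 (holonomy U g m).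
Proof.
move=> Um HE.
have BBi := BBinv BinvB Um; have BiB := BinvB Um.
pose row_of (k : 'I_3) : 'I_5 := if (k : nat) == 0%N then iy
   else if (k : nat) == 1%N then ip else iq.
exists (hol_elt B Binv m), (fun P => \row_k (B m *m P *m Binv m) (row_of k) ix).
split.
- move=> u v; rewrite /hol_elt expmxD !mulmxA; congr (_ *m _ *m _).
  by rewrite -[in RHS](mulmxA _ (B m)) BBi mulmx1.
- apply/seteqP; split => [P [w _ <-]|P /HE[w ->]]; last by exists w.
  by apply/HE; exists w.
- move=> w; apply/rowP => k; rewrite mxE /hol_elt !mulmxA BBi mul1mx -mulmxA BBi mulmx1.
  by rewrite mxE; case: k => -[|[|[|//]]] k3 /=; congr (w _ _); exact: val_inj.
- move=> w; apply: mx_continuous => i j {w}.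
  rewrite (_ : (fun w => _) = fun w => \sum_b (\sum_a Binv m i a * expmx w a b) * B m b j).
    apply: continuous_bigsum => b; apply: continuous_mul;
      last exact: cst_continuous.
    apply: continuous_bigsum => a; apply: continuous_mul.
      exact: cst_continuous.
    move=> w; apply: (@continuous_comp _ _ _ (fun w => expmx w) (fun M => M a b)).
      exact: expmx_continuous.
    exact: coord_continuous.
  by apply/funext => w; rewrite /hol_elt mxE; apply: eq_bigr => b _; rewrite mxE.
- apply: continuous_subspaceT; apply: mx_continuous => i k.
  rewrite (_ : (fun P => _) = fun P : 'M[R]_5 =>
      \sum_b (\sum_a B m (row_of k) a * P a b) * Binv m b ix).
    apply: continuous_bigsum => b; apply: continuous_mul;
      last exact: cst_continuous.
    apply: continuous_bigsum => a; apply: continuous_mul.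
      exact: cst_continuous.
    exact: coord_continuous.
  by apply/funext => P; rewrite mxE mxE; apply: eq_bigr => b _; rewrite mxE.
Qed.

End Iso.

Section SmoothCurves.
Variable R : realType.

Lemma smooth1_row n (d : R -> 'rV[R]_n.+1) :
  (forall i, smooth1_on setT (fun t => d t 0 i)) -> smooth1_on setT d.
Proof.
move=> sd.
suff H k : (forall t i, derive1n k d t 0 i = derive1n k (fun s => d s 0 i) t) /\
    (forall t, derivable (derive1n k d) t 1) by move=> k t _; exact: (H k).2.
elim: k => [|k [IH1 IH2]].
  split => // t; apply/derivable_mxP => i j; rewrite ord1.
  exact: (sd j 0%N t I).
have E t i : derive1n k.+1 d t 0 i = derive1n k.+1 (fun s => d s 0 i) t.
  rewrite !derive1nS !derive1E (derive_mx (IH2 t)) mxE.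
  by congr ('D_1 _ t); apply/funext => s; exact: IH1.
split=> [|t]; first exact: E.
apply/derivable_mxP => i j; rewrite ord1.
rewrite (_ : (fun s => _) = derive1n k.+1 (fun s => d s 0 j)); first exact: (sd j k.+1 t I).
by apply/funext => s; exact: E.
Qed.

Variables (A : Type) (d : A -> dpoly A) (at_ : R -> A -> R).
Hypothesis at_der : forall a (t : R), is_derive t 1 (at_ ^~ a) (deval (at_ t) (d a)).

Lemma is_derive_deval e (t : R) : is_derive t 1 (fun s => deval (at_ s) e)
  (deval (at_ t) (dder (fun _ : unit => d) tt e)).
Proof.
elim: e => [|k|k l|a|e IH|e1 IH1 e2 IH2|e1 IH1 e2 IH2] /=; try exact: is_derive_cst.
- exact: at_der.
- by rewrite deval_opp; exact: is_deriveN.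
- by rewrite deval_add; exact: is_deriveD.
- by rewrite deval_add !deval_mul; exact: is_derive_mul.
Qed.

(** The derivatives of all orders remain polynomials in the given functions. *)
Lemma smooth1_deval e : smooth1_on setT (fun t => deval (at_ t) e).
Proof.
move=> k t _; rewrite (_ : derive1n k _ =
    fun t => deval (at_ t) (iter k (dder (fun _ : unit => d) tt) e)).
  by have [] := is_derive_deval (iter k (dder (fun _ : unit => d) tt) e) t.
elim: k => [//|k IH]; rewrite derive1nS IH; apply/funext => s.
by rewrite derive1E; have [_ ->] := is_derive_deval (iter k (dder (fun _ : unit => d) tt) e) s.
Qed.

End SmoothCurves.

(** * Loops with prescribed holonomy *)

Section Gram.
Variables (R : realType) (n : nat) (f : 'I_n -> R -> R) (h : 'I_n -> 'I_n -> R -> R).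
Hypothesis h_der : forall k b (t : R), is_derive t 1 (h k b) (f k t * f b t).
Hypothesis f_free : forall beta : 'I_n -> R,
  (forall t, 0 < t < 1 -> \sum_b beta b * f b t = 0) -> forall b, beta b = 0.

Lemma vanishing_derivative (q : R -> R) (a b t dq : R) :
  (forall s, a < s < b -> q s = 0) -> a < t < b -> is_derive t 1 q dq -> dq = 0.
Proof.
move=> q0 /andP[at_ tb] qd.
have E : \near t, q t = 0.
  near=> s; apply: q0; apply/andP; split; near: s; [exact: lt_nbhsr|exact: lt_nbhsl].
have [_ <-] := near_eq_is_derive E qd.
exact: derive_cst.
Unshelve. all: by end_near. Qed.

(** The matrix is the Gram matrix of the functions f_b on [0, 1], its entries
    being given by antiderivatives h of the products.  If beta is in its kernel,
    then P 1 - P 0 = 0 for the function P with derivative (\sum_b beta_b f_b)^2;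
    a nondecreasing P is then constant, and the combination vanishes. *)
Lemma gram_unit : \matrix_(b, k) (h k b 1 - h k b 0) \in unitmx.
Proof.
set M := \matrix_(b, k) _.
rewrite -row_free_unit -kermx_eq0; apply/eqP/row_matrixP => i; rewrite row0.
set beta := row i _; have bM : beta *m M = 0 by rewrite -row_mul mulmx_ker row0.
pose P t := \sum_b \sum_k beta 0 b * beta 0 k * h k b t.
pose F t := \sum_b beta 0 b * f b t.
have P1 (t : R) : is_derive t 1 P (F t ^+ 2).
  have D := is_derive_bigsum (fun b => is_derive_bigsum (fun k => is_derive_mul
    (is_derive_cst (beta 0 b * beta 0 k) t 1) (h_der k b t))).
  apply: (is_derive_eq D); rewrite /F expr2 mulr_suml; apply: eq_bigr => b _.
  by rewrite mulr_sumr; apply: eq_bigr => k _; rewrite /=; ring.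
have P10 : P 1 = P 0.
  apply/eqP; rewrite -subr_eq0 /P -sumrB; apply/eqP.
  transitivity ((beta *m M *m beta^T) 0 0); last by rewrite bM mul0mx mxE.
  rewrite mxE; under [RHS]eq_bigr do rewrite !mxE mulr_suml.
  rewrite [RHS]exchange_big /=; apply: eq_bigr => b _; rewrite -sumrB.
  by apply: eq_bigr => k _; rewrite !mxE; ring.
have Pmono (a b : R) : a <= b -> P a <= P b.
  move=> ab; rewrite -subr_ge0.
  have cP : {within `[a, b], continuous P}.
    by apply: derivable_within_continuous => x _; have [] := P1 x.
  have [c _ ->] := MVT_segment ab (fun x _ => P1 x) cP.
  by rewrite mulr_ge0 ?sqr_ge0 ?subr_ge0.
have Pcst t : 0 <= t <= 1 -> P t = P 0.
  move=> /andP[t0 t1]; apply/eqP; rewrite eq_le.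
  by apply/andP; split; [rewrite -P10|]; exact: Pmono.
have F0 t : 0 < t < 1 -> F t = 0.
  move=> t01; apply/eqP; rewrite -sqrf_eq0; apply/eqP.
  apply: (@vanishing_derivative (fun s => P s - P 0) 0 1 t) => //.
    move=> s /andP[s0 s1]; rewrite Pcst ?subrr //.
    by apply/andP; split; exact: ltW.
  have D := P1 t.
  by apply: (is_derive_eq (is_deriveB D (is_derive_cst (P 0) t 1))); rewrite subr0.
by apply/rowP => b; rewrite [RHS]mxE (f_free F0).
Qed.

End Gram.

(** The functions of the time t that occur along the loop: sin(2 pi t),
    cos(2 pi t), constants, and functions of x(t). *)
Inductive latom (R : Type) : Type :=
  | LSin | LCos | LK of R | LI of nat | Lrho | Lrho1 | LO | Lth.

Section Loops.
Variables (R : realType) (J : set R) (I rho rho1 th : R -> R).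
Hypotheses (oJ : open J) (iJ : is_interval J) (I_smooth : smooth1_on J I).
Hypotheses (rho0 : forall x, J x -> rho x != 0)
  (rho_der : forall x : R, J x -> is_derive x 1 rho (rho1 x))
  (rho1_der : forall x : R, J x -> is_derive x 1 rho1 (I x / 3 * rho x))
  (th_der : forall x : R, J x -> is_derive x 1 th ((rho x)^-1 ^+ 2)).
Variables (x0 eps : R).
Hypotheses (eps0 : 0 < eps) (room : forall x, x0 - 2 * eps <= x <= x0 -> J x).
Local Notation lS := (DA (LSin R)).
Local Notation lC := (DA (LCos R)).
Local Notation lK r := (DA (LK (r : R))).
Local Notation lI k := (DA (LI R k)).
Local Notation lrho := (DA (Lrho R)).
Local Notation lrho1 := (DA (Lrho1 R)).
Local Notation lO := (DA (LO R)).
Local Notation lth := (DA (Lth R)).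

Let T : R := pi *+ 2.
Definition loop_x (t : R) : R := x0 + eps * (cos (T * t) - 1).

Definition loopval (t : R) (a : latom R) : R :=
  match a with
  | LSin => sin (T * t)
  | LCos => cos (T * t)
  | LK r => r
  | LI k => derive1n k I (loop_x t)
  | Lrho => rho (loop_x t)
  | Lrho1 => rho1 (loop_x t)
  | LO => (rho (loop_x t))^-1
  | Lth => th (loop_x t)
  end.
Local Notation ev t := (deval (loopval t)).

Definition speed : dpoly (latom R) := (lK (- (eps * T))%R * lS)%D.

Definition loop_rules (a : latom R) : dpoly (latom R) :=
  match a with
  | LSin => lK T * lC
  | LCos => lK (- T)%R * lS
  | LK _ => D0
  | LI k => lI k.+1 * speed
  | Lrho => lrho1 * speed
  | Lrho1 => DQ 1 3 * lI 0 * lrho * speed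
  | LO => (- (lO * lO * lrho1)) * speed
  | Lth => lO * lO * speed
  end%D.

Lemma loop_x_in t : J (loop_x t).
Proof.
apply: room; rewrite /loop_x; have := cos_le1 (T * t); have := cos_geN1 (T * t).
move: (cos _) => c c1 c2; have : eps * -1 <= eps * c by rewrite ler_pM2l.
have : eps * c <= eps * 1 by rewrite ler_pM2l.
by move=> e1 e2; apply/andP; split; lra.
Qed.

Let scale_der (t : R) : is_derive t 1 (fun s => T * s) T.
Proof.
have D := is_derive_mul (is_derive_cst T t 1) (is_derive_id t 1).
by apply: (is_derive_eq D); rewrite mul0r add0r mulr1.
Qed.

Lemma loop_x_der (t : R) : is_derive t 1 loop_x (ev t speed).
Proof.
have D := is_derive1_comp (is_derive_cos (T * t)) (scale_der t).
have D2 := is_deriveB D (is_derive_cst (1 : R) t 1).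
have D3 := is_deriveD (is_derive_cst x0 t 1) (is_derive_mul (is_derive_cst eps t 1) D2).
by apply: (is_derive_eq D3); rewrite /=; ring.
Qed.

Lemma loopval_der a (t : R) : is_derive t 1 (loopval ^~ a) (ev t (loop_rules a)).
Proof.
have Jx := loop_x_in t; have X1 := loop_x_der t.
case: a => [||r|k||||] /=.
- have D := is_derive1_comp (is_derive_sin (T * t)) (scale_der t).
  by apply: (is_derive_eq D); rewrite mulrC.
- have D := is_derive1_comp (is_derive_cos (T * t)) (scale_der t).
  by apply: (is_derive_eq D); rewrite mulrC mulrN mulNr.
- exact: is_derive_cst.
- have /derivableP Id := @I_smooth k _ Jx.
  have D := is_derive1_comp Id X1.
  by apply: (is_derive_eq D); rewrite -derive1E.
- by have D := is_derive1_comp (rho_der Jx) X1.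
- have D := is_derive1_comp (rho1_der Jx) X1.
  by apply: (is_derive_eq D); rewrite /=; field.
- have rd : is_derive (loop_x t) 1 (fun x => (rho x)^-1)
      (- ((rho (loop_x t))^-1 * (rho (loop_x t))^-1 * rho1 (loop_x t))).
    have r1 := rho_der Jx.
    apply: is_derive_eq; first by apply: is_deriveV; exact: rho0.
    by rewrite expr2 invfM [LHS]mulNr.
  by have D := is_derive1_comp rd X1.
- have D := is_derive1_comp (th_der Jx) X1.
  by apply: (is_derive_eq D); rewrite expr2.
Qed.

Lemma loop_x_smooth : smooth1_on setT loop_x.
Proof.
rewrite (_ : loop_x = fun t => ev t (lK x0 + lK eps * (lC - lK (1 : R)))%D) //.
exact: smooth1_deval loopval_der _.
Qed.

Lemma loop_x0 : loop_x 0 = x0.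
Proof. by rewrite /loop_x mulr0 cos0 subrr mulr0 addr0. Qed.

Lemma loop_x1 : loop_x 1 = x0.
Proof. by rewrite /loop_x mulr1 cos2pi subrr mulr0 addr0. Qed.

Definition weightL (k : 'I_3) : dpoly (latom R) :=
  match (k : nat) with
  | 0%N => lrho * lrho * lrho
  | 1%N => lrho * lrho * lrho * lth
  | _ => lrho * lrho * lrho * lth * lth
  end%D.

Definition weight (k : 'I_3) (x : R) : R := rho x ^+ 3 * th x ^+ k.

Lemma weightLE k t : ev t (weightL k) = weight k (loop_x t).
Proof. by case: k => -[|[|[|//]]] k3; rewrite /weight /=; ring. Qed.

Lemma sin_weightLE k t :
  ev t (lS * weightL k)%D = sin (T * t) * weight k (loop_x t).
Proof. by rewrite deval_mul weightLE. Qed.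

(** On ]0, 1/2[ the factor sin(2 pi t) rho^3 can be cancelled, and a polynomial of
    degree at most 2 that vanishes on the values of theta is 0: differentiate in t, the
    derivative of theta having no zero there. *)
Lemma loop_free (beta : 'I_3 -> R) :
  (forall t, 0 < t < 1 -> \sum_b beta b * ev t (lS * weightL b)%D = 0) ->
  forall b, beta b = 0.
Proof.
move=> H; pose b0 := beta k0; pose b1 := beta k1; pose b2 := beta k2.
pose theta t := th (loop_x t).
have sum3 (F : 'I_3 -> R) : \sum_b F b = F k0 + F k1 + F k2.
  by rewrite !big_ord_recr big_ord0 /= add0r; do ![congr (_ + _)]; congr F; exact: val_inj.
have S0 t : 0 < t < 2^-1 -> sin (T * t) != 0.
  move=> /andP[t0 t1]; have p0 := pi_gt0 R; apply: lt0r_neq0; apply: sin_gt0_pi.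
  rewrite /T -mulr_natl; apply/andP; split; first by rewrite !mulr_gt0.
  rewrite -mulrA mulrCA gtr_pMr //; lra.
have r0 t : rho (loop_x t) != 0 by apply: rho0; exact: loop_x_in.
have q0 t : 0 < t < 2^-1 -> b0 + b1 * theta t + b2 * theta t * theta t = 0.
  move=> t01; have t1 : 0 < t < 1 by case/andP: t01 => ? ?; apply/andP; split; lra.
  have := H t t1; rewrite sum3 !sin_weightLE /weight /= -/(theta t) => E.
  apply: (mulfI (S0 t t01)); apply: (mulfI (expf_neq0 3 (r0 t))).
  by rewrite !mulr0 -E /b0 /b1 /b2; ring.
have theta1 (t : R) : is_derive t 1 theta (ev t (loop_rules (Lth R))).
  exact: (loopval_der (Lth R)).
have theta1_neq0 t : 0 < t < 2^-1 -> ev t (loop_rules (Lth R)) != 0.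
  move=> t01; rewrite /= !mulf_neq0 ?invr_neq0 // ?S0 // oppr_eq0 mulf_neq0 //.
    exact: lt0r_neq0.
  by rewrite /T mulrn_eq0 /= lt0r_neq0 // pi_gt0.
have q1 t : 0 < t < 2^-1 -> b1 + 2 * b2 * theta t = 0.
  move=> t01; apply: (mulfI (theta1_neq0 t t01)).
  have D := is_deriveD (is_deriveD (is_derive_cst b0 t 1)
    (is_derive_mul (is_derive_cst b1 t 1) (theta1 t)))
    (is_derive_mul (is_derive_mul (is_derive_cst b2 t 1) (theta1 t)) (theta1 t)).
  have := vanishing_derivative q0 t01 D.
  by rewrite mulr0 => <-; move: (ev t _) => e /=; ring.
pose r : R := 4^-1.
have t01 : 0 < r < 2^-1 by rewrite /r; apply/andP; split; lra.
have q2 : b2 = 0.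
  have D := is_deriveD (is_derive_cst b1 r 1)
    (is_derive_mul (is_derive_cst (2 * b2) r 1) (theta1 r)).
  apply: (mulfI (theta1_neq0 _ t01)); have := vanishing_derivative q1 t01 D.
  rewrite mulr0; move: (ev _ _) => e /= E; lra.
have q1' : b1 = 0 by have := q1 _ t01; rewrite q2 mulr0 mul0r addr0.
have q0' : b0 = 0 by have := q0 _ t01; rewrite q1' q2 !mul0r !addr0.
by case=> -[|[|[|//]]] k3; [rewrite -q0'|rewrite -q1'|rewrite -q2]; congr beta; exact: val_inj.
Qed.

(** The constant part y0 of y contributes the integral of an exact form in x,
    hence 0 over a loop; the oscillating part contributes the Gram matrix
    applied to beta, up to the factor 2 pi eps. *)
Lemma loops (y0 : R) (w : 'rV[R]_3) : exists (y : R -> R) (W : R -> 'rV[R]_3),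
  [/\ smooth1_on setT y, y 0 = y0, y 1 = y0, W 0 = 0 /\ W 1 = w &
   forall (t : R) k, is_derive t 1 (fun s => W s 0 k)
     (derive1 loop_x t * - (y t * weight k (loop_x t)))].
Proof.
have cont e : forall t, setT t -> {for t, continuous (fun s => ev s e)}.
  move=> t _; apply: differentiable_continuous; apply/derivable1_diffP.
  by have [] := is_derive_deval loopval_der e t.
have [h h_der] : exists h : 'I_3 -> 'I_3 -> R -> R, forall k b (t : R),
    is_derive t 1 (h k b) (ev t (lS * weightL k)%D * ev t (lS * weightL b)%D).
  have iT : is_interval [set: R] by [].
  have H k b := antiderivative openT iT (cont ((lS * weightL k) * (lS * weightL b))%D).
  exists (fun k b => sval (cid (H k b))) => k b t.
  by have := svalP (cid (H k b)) t Logic.I; rewrite deval_mul.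
have [E E_der] : exists E : 'I_3 -> R -> R, forall k x, J x ->
    is_derive (x : R) 1 (E k) (weight k x).
  have pow (f : R -> R) n (x : R) : differentiable f x ->
      differentiable (fun y => f y ^+ n) x.
    move=> fd; elim: n => [|n IH]; first exact: differentiable_cst.
    by under eq_fun do rewrite exprS; exact: differentiableM.
  have wc k x : J x -> {for x, continuous (weight k)}.
    move=> Jx; apply: differentiable_continuous.
    apply: (@differentiableM _ _ (fun x => rho x ^+ 3) (fun x => th x ^+ k)).
      by apply: pow; apply/derivable1_diffP; have [] := rho_der Jx.
    by apply: pow; apply/derivable1_diffP; have [] := th_der Jx.
  have H k := antiderivative oJ iJ (wc k).
  by exists (fun k => sval (cid (H k))) => k x Jx; exact: (svalP (cid (H k))).
pose M := \matrix_(b, k) (h k b 1 - h k b 0).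
have Mu : M \in unitmx := gram_unit h_der loop_free.
(* x'(t) = - c sin(2 pi t), and the rate carries another sign. *)
pose c := eps * T.
have c0 : c != 0 by rewrite mulf_neq0 ?lt0r_neq0 // /T -mulr_natl mulr_gt0 // pi_gt0.
pose beta := c^-1 *: (w *m invmx M).
have sum3 (F : 'I_3 -> dpoly (latom R)) t :
    ev t (F k0 + F k1 + F k2)%D = \sum_b ev t (F b).
  rewrite !deval_add !big_ord_recr big_ord0 /= add0r.
  by do ![congr (_ + _)]; congr (ev t (F _)); exact: val_inj.
pose Y := (lK y0 + (lK (beta 0 k0) * (lS * weightL k0)
  + lK (beta 0 k1) * (lS * weightL k1) + lK (beta 0 k2) * (lS * weightL k2)))%D.
have YE t : ev t Y = y0 + \sum_b beta 0 b * ev t (lS * weightL b)%D.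
  rewrite /Y deval_add (sum3 (fun b => lK (beta 0 b) * (lS * weightL b))%D).
  by congr (_ + _); apply: eq_bigr => b _; rewrite deval_mul.
pose W t : 'rV[R]_3 := \row_k (- y0 * (E k (loop_x t) - E k x0)
  + c * \sum_b beta 0 b * (h k b t - h k b 0)).
exists (fun t => ev t Y), W; split.
- exact: smooth1_deval loopval_der Y.
- rewrite YE big1 ?addr0 // => b _.
  by rewrite sin_weightLE mulr0 sin0 mul0r mulr0.
- rewrite YE big1 ?addr0 // => b _.
  by rewrite sin_weightLE mulr1 sin2pi mul0r mulr0.
- split; first last.
    apply/rowP => k; rewrite mxE loop_x1 subrr mulr0 add0r.
    transitivity ((c *: (beta *m M)) 0 k).
      by rewrite mxE mxE; congr (_ * _); apply: eq_bigr => b _; rewrite [M _ _]mxE.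
    by rewrite /beta -scalemxAl mulmxKV // scalerA mulfV // scale1r.
  apply/rowP => k; rewrite !mxE loop_x0 subrr mulr0 add0r big1 ?mulr0 // => b _.
  by rewrite subrr mulr0.
- move=> t k.
  have D1 := is_derive1_comp (E_der k _ (loop_x_in t)) (loop_x_der t).
  have D2 := is_derive_mul (is_derive_cst (- y0) t 1)
    (is_deriveB D1 (is_derive_cst (E k x0) t 1)).
  have D3 := is_derive_bigsum (fun b => is_derive_mul (is_derive_cst (beta 0 b) t 1)
    (is_deriveB (h_der k b t) (is_derive_cst (h k b 0) t 1))).
  have D := is_deriveD D2 (is_derive_mul (is_derive_cst c t 1) D3).
  rewrite (_ : (fun s => W s 0 k) = (fun s => - y0 * (E k (loop_x s) - E k x0)
     + c * \sum_b beta 0 b * (h k b s - h k b 0))); last first.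
    by apply/funext => s; rewrite mxE.
  apply: (is_derive_eq D).
  have -> : derive1 loop_x t = ev t speed.
    by rewrite derive1E; have [_ ->] := loop_x_der t.
  rewrite YE; set sum := \sum_b beta 0 b * ev t (lS * weightL b)%D.
  transitivity (- y0 * (weight k (loop_x t) * ev t speed)
      + c * (ev t (lS * weightL k)%D * sum)).
    rewrite /cst /= !mul0r !add0r subr0; congr (_ + c * _).
    rewrite /sum mulr_sumr; apply: eq_bigr => b _.
    by rewrite mul0r add0r subr0; ring.
  rewrite sin_weightLE [ev t speed]/= -/c; ring.
Qed.

End Loops.

(** * Ricci-flat representatives *)

Section Reduction.
Variables (R : realType) (J : set R) (I : R -> R) (sigma : 'rV[R]_5 -> R).
Hypotheses (oJ : open J) (iJ : is_interval J) (I_smooth : smooth1_on J I).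
Hypotheses (sigma_smooth : smooth_on (MI J) sigma)
  (sigma0 : forall m, MI J m -> sigma m != 0).
Variable g : 'rV[R]_5 -> 'M[R]_5.
Hypothesis gE0 : forall m, MI J m -> g m = (sigma m)^-1 ^+ 2 *: gI I m.
Hypothesis flat : ricci_flat_on (MI J) g.
Local Notation U := (MI J).

Definition axis (x : R) : 'rV[R]_5 := x *: delta_mx 0 ix.
Definition axis_sigma x := sigma (axis x).
Definition axis_sigma1 x := partial ix sigma (axis x).

Lemma axisE x i : axis x 0 i = x * (i == ix)%:R.
Proof. by rewrite !mxE eqxx. Qed.

Lemma axis_in x : J x -> U (axis x).
Proof. by move=> Jx; rewrite /MI /= axisE eqxx mulr1. Qed.

(** The hyperplane x = constant is connected, and the other partial derivatives
    of sigma vanish. *)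
Lemma sigma_axis m : U m -> sigma m = axis_sigma (m 0 ix).
Proof.
move=> Um; pose v := axis (m 0 ix) - m.
have v0 : v 0 ix = 0 by rewrite /v mxE axisE eqxx mulr1 mxE subrr.
have cd (t : R) : is_derive t 1 (fun s : R => m + s *: v) v.
  have dm : differentiable (fun s : R => m + s *: v) t by [].
  apply: DeriveDef; first exact: diff_derivable.
  by rewrite deriveE // diff_val /= fctE /= scale1r add0r.
have Ut (t : R) : U (m + t *: v) by rewrite /MI /= mxE [X in _ + X]mxE v0 mulr0 addr0.
have sd (t : R) : is_derive t 1 (fun s => sigma (m + s *: v)) 0.
  have D := is_derive_curve (cd t) (@sigma_smooth [::] _ (Ut t)).
  apply: (is_derive_eq D); rewrite sum5 v0 mul0r add0r.
  by rewrite (sigma_y0 oJ I_smooth sigma_smooth sigma0 gE0 flat) //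
    (sigma_p0 oJ I_smooth sigma_smooth sigma0 gE0 flat) //
    (sigma_q0 oJ I_smooth sigma_smooth sigma0 gE0 flat) //
    (sigma_z0 oJ I_smooth sigma_smooth sigma0 gE0 flat) // !mulr0 !addr0.
have := is_derive_0_is_cst 0 1 sd.
by rewrite scale0r addr0 scale1r /v addrC subrK.
Qed.

Lemma axis_der (f : 'rV[R]_5 -> R) x : differentiable f (axis x) ->
  is_derive x 1 (fun s => f (axis s)) (partial ix f (axis x)).
Proof.
move=> fd; have := @is_derive_line _ _ f 0 ix x.
rewrite add0r => /(_ fd); rewrite (_ : (fun s => _) = fun s => f (axis s)) //.
by apply/funext => s; rewrite add0r.
Qed.

Lemma axis_sigma_der x : J x -> is_derive x 1 axis_sigma (axis_sigma1 x).
Proof.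
by move=> Jx; apply: axis_der; exact: (@sigma_smooth [::] _ (axis_in Jx)).
Qed.

Lemma axis_sigma1_der x : J x ->
  is_derive x 1 axis_sigma1 (I x / 3 * axis_sigma x).
Proof.
move=> Jx; have Ux := axis_in Jx.
have := axis_der (@sigma_smooth [:: ix] _ Ux).
rewrite (_ : partial ix (foldr _ _ _) _ = I x / 3 * axis_sigma x) //=.
by rewrite (sigma_ode oJ I_smooth sigma_smooth sigma0 gE0 flat) // axisE eqxx mulr1.
Qed.

Lemma axis_sigma_neq0 x : J x -> axis_sigma x != 0.
Proof. by move=> Jx; apply: sigma0; exact: axis_in. Qed.

Variable th : R -> R.
Hypothesis th_der : forall x : R, J x -> is_derive x 1 th ((axis_sigma x)^-1 ^+ 2).
Local Notation fval := (faval I axis_sigma axis_sigma1 th).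

Lemma partial_sigma m i : U m ->
  partial i sigma m = if (i : nat) is 0%N then axis_sigma1 (m 0 ix) else 0.
Proof.
move=> Um.
rewrite (eq_on_partial (open_MI oJ) (g := fun m => axis_sigma (m 0 ix))) //;
  last exact: sigma_axis.
have [sd sE] := axis_sigma_der Um.
have [_ ->] := partial_coord i sd; rewrite derive1E sE.
by move: i; apply: ord5_ind => /=; rewrite ?mul0r ?mul1r.
Qed.

Lemma jet_frame a m : U m -> first_order a ->
  jetval I sigma m a = deval (fval m) (jet_to_frame a).
Proof.
move=> Um; case: a => [i|k|[|i [|//]]|] //= _.
- exact: sigma_axis.
- by rewrite partial_sigma //; case: (i : nat).
- by rewrite sigma_axis.
Qed.

Lemma g_frame m i j : U m -> g m i j = deval (fval m) (gF i j).
Proof.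
move=> Um; rewrite (g_jet oJ I_smooth sigma_smooth sigma0 gE0) //.
apply: (deval_dsubst (P := first_order)) => [a|]; first exact: jet_frame.
by move: i j; apply: ord5_ind; apply: ord5_ind.
Qed.

Lemma ginv_frame m i j : U m ->
  deval (jetval I sigma m) (ginvE i j) = deval (fval m) (ginvF i j).
Proof.
move=> Um; apply: (deval_dsubst (P := first_order)) => [a|]; first exact: jet_frame.
by move: i j; apply: ord5_ind; apply: ord5_ind.
Qed.

Lemma christoffel_frame m k i j : U m ->
  christoffel g k i j m = deval (fval m) (christoffelF k i j).
Proof.
move=> Um; rewrite (christoffel_jet oJ I_smooth sigma_smooth sigma0 gE0) //.
apply: (deval_dsubst (P := first_order)) => [a|]; first exact: jet_frame.
by move: k i j; do 3! apply: ord5_ind.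
Qed.

(** d_z preserves g, and g(d_z, _) = - 3/2 rho^-2 dx is closed. *)
Lemma dz_parallel : parallel_on U g (fun=> delta_mx 0 iz).
Proof.
split=> [|m Um i k]; first exact: smooth_on_cst.
rewrite [X in X + _](_ : _ = 0) ?add0r; last exact: derive_cst.
rewrite sum5 !mxE /= !mulr0 !add0r mulr1 christoffel_frame //.
transitivity (deval (fval m) D0) => //; move: (fval m) => v {Um}.
by move: k i; apply: ord5_ind; apply: ord5_ind; dpoly_compute; field.
Qed.

Lemma dz_null : null_on U g (fun=> delta_mx 0 iz).
Proof.
move=> m Um; rewrite -rowE; apply/matrixP => i j; rewrite !ord1.
rewrite mxE (bigD1 iz) //= big1 => [|k kz]; last first.
  by rewrite !mxE (negPf kz) andbF mulr0.
by rewrite !mxE !eqxx mulr1 addr0 g_frame // /=.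
Qed.

Definition coframe m : 'M[R]_5 := \matrix_(a, j) deval (fval m) (coframeF a j).
Definition inv_coframeF (i a : 'I_5) : dpoly fatom :=
  dsum5 (fun j => ginvF i j * dsum5 (fun b => coframeF b j * pairingF b a))%D.
Definition inv_coframe m : 'M[R]_5 :=
  \matrix_(i, a) deval (fval m) (inv_coframeF i a).
Definition rate m : 'rV[R]_3 := \row_k deval (fval m) (rateF k).

Let fdiff e m : U m -> differentiable (fun m' => deval (fval m') e) m.
Proof.
exact: (faval_diff I_smooth axis_sigma_neq0 axis_sigma_der axis_sigma1_der th_der).
Qed.

Lemma coframe_diff m a j : U m -> differentiable (fun m' => coframe m' a j) m.
Proof. by move=> Um; under eq_fun do rewrite mxE; exact: fdiff. Qed.

Lemma inv_coframe_diff m a j : U m ->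
  differentiable (fun m' => inv_coframe m' a j) m.
Proof. by move=> Um; under eq_fun do rewrite mxE; exact: fdiff. Qed.

(** From g = B^T K B one gets g^-1 B^T K B = 1, so that g^-1 B^T K inverts B. *)
Lemma inv_coframeK m : U m -> inv_coframe m *m coframe m = 1%:M.
Proof.
move=> Um; rewrite -(ginv_mul oJ I_smooth sigma_smooth sigma0 gE0 Um).
apply/matrixP => i j; rewrite mxE [RHS]mxE.
transitivity (\sum_a \sum_k \sum_b deval (fval m) (ginvF i k) *
  (deval (fval m) (pairingF b a) *
   (deval (fval m) (coframeF b k) * deval (fval m) (coframeF a j)))).
  apply: eq_bigr => a _; rewrite !mxE /inv_coframeF deval_dsum5 mulr_suml.
  apply: eq_bigr => k _; rewrite deval_mul deval_dsum5 mulr_sumr mulr_suml.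
  by apply: eq_bigr => b _; rewrite deval_mul; ring.
rewrite exchange_big /=; apply: eq_bigr => k _.
rewrite mxE ginv_frame // (coframe_metric (th := th) axis_sigma_neq0 g_frame) //.
rewrite exchange_big /= mulr_sumr; apply: eq_bigr => b _.
by rewrite mulr_sumr; apply: eq_bigr => a _.
Qed.

Lemma nilmx_rate m a b : U m ->
  nilmx (rate m) a b = deval (fval m) (connectionF a b).
Proof.
move=> _; rewrite mxE; move: a b; apply: ord5_ind; apply: ord5_ind => //=;
  rewrite !mxE /=; by field.
Qed.

Lemma coframe_partial m a i j : U m ->
  partial i (fun m' => coframe m' a j) m =
  \sum_k coframe m a k * christoffel g k i j m +
  (i == ix)%:R * \sum_b nilmx (rate m) a b * coframe m b j.
Proof.
move=> Um; have E := coframe_eq I_smooth axis_sigma_neq0 axis_sigma_der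
  axis_sigma1_der th_der christoffel_frame a i j Um.
rewrite (_ : partial i _ m = partial i (fun m' => deval (fval m') (coframeF a j)) m);
  last by congr partial; apply/funext => m'; rewrite mxE.
move/eqP: E; rewrite subr_eq addrC => /eqP ->; congr (_ + _).
  by apply: eq_bigr => k _; rewrite mxE.
congr (_ * _); apply: eq_bigr => b _.
by rewrite nilmx_rate // mxE.
Qed.

Lemma holonomy_R3 m : U m -> isomorphic_to_Rn 3 (holonomy U g m).
Proof.
move=> Um; apply: (holonomy_iso inv_coframeK Um) => P; split.
  exact: (holonomy_sub coframe_diff inv_coframeK coframe_partial Um).
move=> [w ->].
have [e e0 [Je _]] := open_room oJ Um.
pose eps := e / 2; have eps0 : 0 < eps by rewrite divr_gt0.
have room x : m 0 ix - 2 * eps <= x <= m 0 ix -> J x.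
  by apply: iJ => //; rewrite /eps mulrC divfK.
have [y [W [ys y0 y1 [W0 W1] Wd]]] := loops oJ iJ I_smooth axis_sigma_neq0
  axis_sigma_der axis_sigma1_der th_der eps0 room (m 0 iy) w.
pose lx := loop_x (m 0 ix) eps.
pose d t : 'rV[R]_5 := \row_i (if i == ix then lx t
  else if i == iy then y t else m 0 i).
have ds : smooth1_on setT d.
  apply: smooth1_row => i.
  rewrite (_ : (fun t => _) = if i == ix then lx else if i == iy then y else fun=> m 0 i);
    last by apply/funext => t; rewrite mxE; do 2?case: ifP.
  case: ifP => _; first exact: (loop_x_smooth I_smooth axis_sigma_neq0
    axis_sigma_der axis_sigma1_der th_der eps0 room).
  case: ifP => _; first exact: ys.
  apply: (@smooth1_deval R unit (fun=> D0) (fun=> fun=> m 0 i) _ (DA tt)) => a t.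
  exact: is_derive_cst.
rewrite -W1; apply: (holonomy_sup coframe_diff inv_coframe_diff inv_coframeK
  coframe_partial (d := d)) => //.
- move=> t _; rewrite /MI /= mxE eqxx.
  exact: (loop_x_in eps0 room).
- apply/rowP => i; rewrite mxE y0 /lx loop_x0.
  by do 2?case: eqP => [->|_].
- apply/rowP => i; rewrite mxE y1 /lx loop_x1.
  by do 2?case: eqP => [->|_].
move=> t k _; apply: (is_derive_eq (Wd t k)).
have -> : derive1 d t 0 ix = derive1 lx t.
  rewrite !derive1E derive_mx; last by have := @ds 0%N t Logic.I; rewrite derive1n0.
  by rewrite mxE; congr ('D_1 _ t); apply/funext => s; rewrite mxE.
congr (_ * _); rewrite mxE /weight /=.
case: k => -[|[|[|//]]] k3 /=; rewrite !mxE /=; ring.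
Qed.

End Reduction.

Theorem proposition33 (R : realType) (J : set R) (I : R -> R)
    (J_open : open J) (J_interval : is_interval J) (J_nonempty : J !=set0)
    (I_smooth : smooth1_on J I)
    (g : 'rV[R]_5 -> 'M[R]_5)
    (g_conf : conformal_class (MI J) (gI I) g)
    (g_flat : ricci_flat_on (MI J) g) :
  (exists X : 'rV[R]_5 -> 'rV[R]_5,
     [/\ parallel_on (MI J) g X,
         null_on (MI J) g X
       & forall m, MI J m -> X m != 0]) /\
  (forall m : 'rV[R]_5, MI J m -> isomorphic_to_Rn 3 (holonomy (MI J) g m)).
Proof.
case: g_conf => Om [Om_smooth Om_gt0 gE].
pose sigma m := (Om m)^-1.
have Om0 m : MI J m -> Om m != 0 by move=> /Om_gt0 /lt0r_neq0.
have sigma_smooth : smooth_on (MI J) sigma.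
  by apply: smooth_on_inv => //; exact: open_MI.
have sigma0 m : MI J m -> sigma m != 0 by move=> /Om0; rewrite invr_eq0.
have gE' m : MI J m -> g m = (sigma m)^-1 ^+ 2 *: gI I m.
  by move=> /gE ->; rewrite invrK.
have [th th_der] : exists th : R -> R, forall x, J x ->
    is_derive x 1 th ((axis_sigma sigma x)^-1 ^+ 2).
  apply: (antiderivative J_open J_interval) => x Jx.
  have [sd _] := axis_sigma_der sigma_smooth Jx.
  have : differentiable (fun x => (axis_sigma sigma x)^-1) x.
    by apply: differentiableV; [exact/derivable1_diffP|exact: axis_sigma_neq0 sigma0 _ Jx].
  by move=> /differentiable_continuous c; apply: cvgM.
split; last first.
  move=> m; exact: (holonomy_R3 J_open J_interval I_smooth
  sigma_smooth sigma0 gE' g_flat th_der).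
exists (fun=> delta_mx 0 iz); split.
- exact: (dz_parallel J_open I_smooth sigma_smooth sigma0 gE' g_flat).
- exact: (dz_null J_open I_smooth sigma_smooth sigma0 gE' g_flat th).
- move=> m _; apply/eqP => /rowP/(_ iz)/eqP.
  by rewrite !mxE !eqxx oner_eq0.
Qed.
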